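(* Let $n\ge 2$ be an integer and let $\boldsymbol{\alpha}\in\mathbb{R}^{n-1}$. Consider the one-dimensional affine coordinate subspace $\{\boldsymbol{\alpha}\}\times\mathbb{R}\subseteq\mathbb{R}^n$. (i) If $\tau_D(\boldsymbol{\alpha})>n$, then $\{\boldsymbol{\alpha}\}\times\mathbb{R}$ is contained in the set of very well approximable vectors $$\mathrm{VWA}_n=\{\mathbf{x}\in\mathbb{R}^n:\ \exists\,\varepsilon>0\text{ such that }\|q\mathbf{x}\|<q^{-1/n-\varepsilon}\text{ for infinitely many }q\in\mathbb{N}\}.$$ (ii) If $\tau_D(\boldsymbol{\alpha})<n$, then $\{\boldsymbol{\alpha}\}\times\mathbb{R}$ is of Khintchine type for divergence. That is, for every approximating function $\psi$ with $\sum_{q=1}^\infty\psi(q)^n=\infty$, for Lebesgue-almost every $\beta\in\mathbb{R}$ the point $(\boldsymbol{\alpha},\beta)\in\mathbb{R}^n$ is $\psi$-approximable.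
   Context: For $\mathbf{x}\in\mathbb{R}^k$, $\|\mathbf{x}\|=\min_{\mathbf{z}\in\mathbb{Z}^k}\max_j|x_j-z_j|$ is the distance to the nearest integer point, and $|\cdot|$ is the max-norm. An approximating function is a positive-valued decreasing (i.e. non-increasing) function $\psi$ defined on the positive reals. A point $\mathbf{x}\in\mathbb{R}^n$ is $\psi$-approximable if $\|q\mathbf{x}\|<\psi(q)$ for infinitely many $q\in\mathbb{N}$. The dual Diophantine type of $\boldsymbol{\alpha}\in\mathbb{R}^\ell$ is $$\tau_D(\boldsymbol{\alpha})=\sup\{\tau\in\mathbb{R}^+:\ \|\mathbf{q}\cdot\boldsymbol{\alpha}\|<|\mathbf{q}|^{-\tau}\text{ for infinitely many }\mathbf{q}\in\mathbb{Z}^\ell\setminus\{\mathbf{0}\}\}\in[0,\infty],$$ where $\mathbf{q}\cdot\boldsymbol{\alpha}$ is the standard scalar product and, for a real number $x$, $\|x\|$ is its distance to the nearest integer. *)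

(* Defs.v *)
From HB Require Import structures.
From mathcomp Require Import all_boot all_order all_algebra.
From mathcomp Require Import all_classical all_reals all_analysis.
Import Order.TTheory GRing.Theory Num.Theory.
Import numFieldNormedType.Exports.

Set Implicit Arguments.
Unset Strict Implicit.
Unset Printing Implicit Defensive.

Local Open Scope classical_set_scope.
Local Open Scope ring_scope.

(* The norm on ['rV[R]_k] is the max-norm, and the infimum over integer points
   is attained, so it is a minimum. *)
Definition dist_int_vec (R : realType) (k : nat) (x : 'rV[R]_k) : R :=
  inf [set `|x - map_mx intr z| | z in [set: 'rV[int]_k]].

Definition dist_int (R : realType) (x : R) : R :=
  inf [set `|x - z%:~R| | z in [set: int]].

Definition approximating_function (R : realType) (psi : R -> R) : Prop :=
  (forall x, 0 < x -> 0 < psi x) /\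
  (forall x y, 0 < x -> x <= y -> psi y <= psi x).

Definition approximable (R : realType) (n : nat) (psi : R -> R)
    (x : 'rV[R]_n) : Prop :=
  infinite_set
    [set q : nat | (0 < q)%N /\ dist_int_vec (q%:R *: x) < psi q%:R].

Definition VWA (R : realType) (n : nat) : set 'rV[R]_n :=
  [set x | exists2 eps : R, 0 < eps &
     infinite_set [set q : nat | (0 < q)%N /\
       dist_int_vec (q%:R *: x) < q%:R `^ (- n%:R^-1 - eps)]].

(* For [0 < l] the set contains a real number, by Dirichlet's theorem, so the
   supremum is not the [-oo] that [ereal_sup] gives on the empty set. *)
Definition dual_type (R : realType) (l : nat) (alpha : 'rV[R]_l) : \bar R :=
  ereal_sup [set tau%:E | tau in [set tau : R | 0 < tau /\
    infinite_set [set q : 'rV[int]_l | q != 0 /\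
      dist_int (\sum_j (q 0 j)%:~R * alpha 0 j)
        < `|map_mx intr q : 'rV[R]_l| `^ (- tau)]]].

(* The point [(alpha, beta)]: entry [j] is [alpha_j] for [j < n.-1], and
   [beta] for the last index. *)
Definition line_point (R : realType) (n : nat) (alpha : 'rV[R]_n.-1)
    (beta : R) : 'rV[R]_n :=
  \row_(j < n) oapp (fun i : 'I_n.-1 => alpha 0 i) beta (insub (j : nat)).

Definition coord_line (R : realType) (n : nat) (alpha : 'rV[R]_n.-1) :
    set 'rV[R]_n :=
  range (@line_point R n alpha).

Definition khintchine_divergence_line (R : realType) (n : nat)
    (alpha : 'rV[R]_n.-1) : Prop :=
  forall psi : R -> R, approximating_function psi ->
    (\sum_(1 <= q <oo) (psi q%:R ^+ n)%:E)%E = +oo%E ->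
    {ae @lebesgue_measure R, forall beta : R,
       approximable psi (@line_point R n alpha beta)}.

(* Main.v *)
Require Import Defs.
From mathcomp Require Import all_boot all_order all_algebra.
From mathcomp Require Import all_classical all_reals all_analysis.
From mathcomp Require Import measurable_realfun ring lra zify.
Import Order.TTheory GRing.Theory Num.Theory.
Import numFieldNormedType.Exports.

Set Implicit Arguments.
Unset Strict Implicit.
Unset Printing Implicit Defensive.

Local Open Scope classical_set_scope.
Local Open Scope ring_scope.

(** Part (i) is a transference argument by pigeonhole: if h is an integer vector
of norm H with h.alpha within H^-tau of an integer, tau > n, then among the q up
to m^(n-1) H two have fractional parts of q alpha_i (i <> k, |h_k| = H) and of
q beta in the same cells of size 1/m and agree modulo h_k in the linear form
that determines the last coordinate; their difference Q satisfies
|Q (alpha, beta)| <= n/m, and m ~ H^(tau/n) beats the exponent 1/n.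

Part (ii) is a ubiquity argument.  If tau_D(alpha) < tau < n, the points j.alpha
with 0 <= j_i < H are c H^-tau separated modulo 1, and a large sieve inequality
bounds the number of q <= M with |q alpha| < delta by C M delta^(n-1) as soon as
delta^-tau = O(M).  Hence in the Dirichlet covering of an interval by balls
around p/q, with q <= N and |q alpha| < delta, the denominators q <= N/B cover
only O(1/B) of the length, and the remaining balls all have comparable radius.
At the scales N = B^l, with delta about psi(N), shrinking these balls to radius
delta/N captures a proportion a = N delta^n of any set that is not too
fragmented.  If the points approximable beyond some Q missed a set of measure
f > 0, each scale would add a measure at least of the order of f a to the union
of the shrunken balls, although the sum of the a's diverges.  Fragmentation is
controlled by using only the scales at which delta is not much smaller than the
earlier ones predict; these carry a fixed proportion of the divergent sum. *)

(** * Integer points and pigeonhole *)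

Lemma dist_int_ltP (R : realType) (x t : R) :
  dist_int x < t <-> exists z : int, `|x - z%:~R| < t.
Proof.
have lb : has_lbound [set `|x - z%:~R| | z in [set: int]].
  by exists 0 => _ [z _ <-].
split=> [|[z xz]].
  move=> /inf_lt[|_ [z _ <-] xz]; first by exists `|x - 0%:~R|, 0.
  by exists z.
by apply: le_lt_trans xz; apply: ge_inf => //; exists z.
Qed.

(** Positivity of [t] covers the empty row, whose norm is 0 while the condition on the entries is
    vacuous. *)
Lemma row_norm_ltP (R : realType) (k : nat) (x : 'rV[R]_k) (t : R) :
  0 < t -> (`|x| < t <-> forall i, `|x 0 i| < t).
Proof.
move=> t0; rewrite [`|x|]/Num.Def.normr/= mx_normrE; split=> [/bigmax_ltP[_ xt] i|xt].
  exact: (xt (0, i)).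
by apply/bigmax_ltP; split=> // -[i j] _ /=; rewrite ord1.
Qed.

Lemma row_norm_leP (R : realType) (k : nat) (x : 'rV[R]_k) (t : R) :
  0 <= t -> (`|x| <= t <-> forall i, `|x 0 i| <= t).
Proof.
move=> t0; rewrite [`|x|]/Num.Def.normr/= mx_normrE; split=> [/bigmax_leP[_ xt] i|xt].
  exact: (xt (0, i)).
by apply/bigmax_leP; split=> // -[i j] _ /=; rewrite ord1.
Qed.

Lemma dist_int_vec_ltP (R : realType) (k : nat) (x : 'rV[R]_k) (t : R) :
  0 < t ->
  (dist_int_vec x < t <-> forall i, exists z : int, `|x 0 i - z%:~R| < t).
Proof.
move=> t0.
have lb : has_lbound [set `|x - map_mx intr z| | z in [set: 'rV[int]_k]].
  by exists 0 => _ [z _ <-].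
split=> [|xt].
  move=> /inf_lt[|_ [z _ <-] xz]; first by exists `|x - map_mx intr 0|, 0.
  move=> i; exists (z 0 i).
  by have /row_norm_ltP-/(_ t0 i) := xz; rewrite !mxE.
have [z zt] := choice xt.
apply: (@le_lt_trans _ _ `|x - map_mx intr (\row_i z i)|).
  by apply: ge_inf => //; exists (\row_i z i).
by apply/row_norm_ltP => // i; rewrite !mxE.
Qed.

Lemma line_point_lift (R : realType) (n : nat) (alpha : 'rV[R]_n.-1) (beta : R)
    (i : 'I_n.-1) (j : 'I_n) : val j = val i -> line_point alpha beta 0 j = alpha 0 i.
Proof.
by move=> ji; rewrite mxE ji insubT //= => ?; congr (alpha _ _); apply: val_inj.
Qed.

Lemma dist_line_point_ltP (R : realType) (n : nat) (alpha : 'rV[R]_n.-1)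
    (beta : R) (q : nat) (t : R) : (0 < n)%N -> 0 < t ->
  (dist_int_vec (q%:R *: line_point alpha beta) < t <->
   (forall i, exists z : int, `|q%:R * alpha 0 i - z%:~R| < t) /\
   exists z : int, `|q%:R * beta - z%:~R| < t).
Proof.
move=> n0 t0; rewrite dist_int_vec_ltP //; split=> [xt|[alphat betat] j].
  split=> [i|].
    have ilt : (i < n)%N by rewrite (leq_trans (ltn_ord i)) ?leq_pred.
    have [z] := xt (Ordinal ilt).
    by rewrite mxE (@line_point_lift _ _ _ _ i) // => ?; exists z.
  have nlt : (n.-1 < n)%N by rewrite prednK.
  have [z] := xt (Ordinal nlt); rewrite !mxE insubF ?ltnn //= => ?.
  by exists z.
rewrite !mxE; case: insubP => [i _ _|_] /=; [exact: alphat|exact: betat].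
Qed.

Lemma finite_set_pos_lbound (R : realType) (T : choiceType) (A : set T) (g : T -> R) :
  finite_set A -> (forall x, A x -> 0 < g x) ->
  exists2 c, 0 < c & forall x, A x -> c <= g x.
Proof.
move=> /finite_seqP[s ->] gpos; exists (\big[Num.min/1]_(x <- s) g x).
  rewrite big_seq_cond; elim/big_ind : _ => //.
    by move=> x y x0 y0; rewrite lt_min x0 y0.
  by move=> x /andP[xs _]; exact: gpos.
move=> x; rewrite /=; elim: s {gpos} => // y s IHs; rewrite inE big_cons ge_min.
by move=> /orP[/eqP ->|/IHs ->]; rewrite ?lexx ?orbT.
Qed.

Lemma finite_int_vec_bounded (l B : nat) :
  finite_set [set h : 'rV[int]_l | forall i, (absz (h 0%R i) <= B)%N].
Proof.
pose f (u : {ffun 'I_l -> 'I_(B + B).+1}) : 'rV[int]_l := \row_i (u i)%:Z - const_mx B%:Z.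
apply: (@sub_finite_set _ _ (range f)); last exact: finite_image.
move=> h hB; exists [ffun i => inord (absz (h 0%R i + B%:Z))] => //.
apply/rowP => i; rewrite !mxE ffunE inordK; last first.
  by have := hB i; lia.
by have := hB i; lia.
Qed.

(** The index [j] of the interval [j/m, (j+1)/m) that contains the fractional part of [x]. *)
Definition cell (R : realType) (m : nat) (x : R) : nat :=
  Num.truncn (m%:R * (x - (Num.floor x)%:~R)).

Lemma cell_lt (R : realType) (m : nat) (x : R) : (0 < m)%N -> (cell m x < m)%N.
Proof.
move=> m0; have mR0 : 0 < m%:R :> R by rewrite ltr0n.
have f0 : 0 <= x - (Num.floor x)%:~R by rewrite subr_ge0; exact: floor_le.
have f1 : x - (Num.floor x)%:~R < 1.
  by rewrite ltrBlDl; have := floorD1_gt x; rewrite intrD.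
rewrite -(ltr_nat R); apply: (@le_lt_trans _ _ (m%:R * (x - (Num.floor x)%:~R))).
  by rewrite truncn_le mulr_ge0.
by rewrite gtr_pMr.
Qed.

Lemma cell_eq_dist (R : realType) (m : nat) (x y : R) : (0 < m)%N ->
  cell m x = cell m y ->
  `|(y - x) - (Num.floor y - Num.floor x)%:~R| < m%:R^-1.
Proof.
move=> m0 cxy; have mR0 : 0 < m%:R :> R by rewrite ltr0n.
have c1 (z : R) : (cell m z)%:R <= m%:R * (z - (Num.floor z)%:~R).
  by rewrite truncn_le mulr_ge0 // subr_ge0 floor_le.
have c2 (z : R) : m%:R * (z - (Num.floor z)%:~R) < (cell m z)%:R + 1.
  by rewrite natr1; exact: Num.Theory.truncnS_gt.
rewrite -[_^-1]mul1r ltr_pdivlMr // -[X in _ * X](gtr0_norm mR0) -normrM intrB.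
have := c1 x; have := c2 x; have := c1 y; have := c2 y; rewrite cxy => h1 h2 h3 h4.
by rewrite ltr_norml; apply/andP; split; lra.
Qed.

(** Dirichlet's argument: the N + 1 integers from 0 to [N] fall into at most [N] classes. The free
    [key] lets one application impose a congruence and another a cell of a different size. *)
Lemma pigeonhole_fractional (R : realType) (T K : finType) (x : T -> R)
    (key : nat -> K) (m N : nat) : (0 < m)%N -> (m ^ #|T| * #|K| <= N)%N ->
  exists q1 q2 : nat, [/\ (q1 < q2 <= N)%N, key q1 = key q2 &
    forall i, `|(q2 - q1)%:R * x i
       - (Num.floor (q2%:R * x i) - Num.floor (q1%:R * x i))%:~R| < m%:R^-1].
Proof.
move=> m0 mN.
pose F (q : 'I_N.+1) : {ffun T -> 'I_m} * K :=
  ([ffun i => Ordinal (cell_lt (q%:R * x i) m0)], key q).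
have /injectivePn[q [q' qq' Fqq']] : ~~ injectiveb F.
  apply/negP => /injectiveP Finj; have := leq_card F Finj.
  by rewrite card_ord card_prod card_ffun card_ord ltnNge mN.
wlog ltqq' : q q' qq' Fqq' / (q < q')%N.
  move=> wl; have [|lt|eq] := ltngtP q q'; first exact: wl.
    by apply: (wl q' q) => //; rewrite eq_sym.
  by move/eqP: qq' => []; apply: val_inj.
exists q, q'; split; [by rewrite ltqq' -ltnS ltn_ord | by case: Fqq' |].
move=> i; case: Fqq' => /ffunP/(_ i); rewrite !ffunE => -[ceq] _.
by rewrite natrB ?(ltnW ltqq') // mulrBl; exact: cell_eq_dist.
Qed.

(** * Transference *)

(* Besides the cells of the fractional parts, the pigeonhole key records
   [p q - \sum_(i <> k) h_i floor(q x_i)] modulo [h_k]: when two keys agree, the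
   difference is divisible by [h_k], and the quotient is the integer close to
   [Q alpha_k]. *)
Lemma dual_to_simultaneous (R : realType) (d : nat) (alpha : 'rV[R]_d) (beta : R)
    (h : 'rV[int]_d) (k : 'I_d) (p : int) (m : nat) :
  h 0 k != 0 -> (forall i, `|h 0 i| <= `|h 0 k|) -> (0 < m)%N ->
  let del := `|\sum_j (h 0 j)%:~R * alpha 0 j - p%:~R| in
  exists Q : nat, [/\ (0 < Q <= m ^ d * absz (h 0%R k))%N,
    forall i, exists z : int,
      `|Q%:R * alpha 0 i - z%:~R| < d%:R / m%:R + (m ^ d)%:R * del &
    exists z : int, `|Q%:R * beta - z%:~R| < m%:R^-1].
Proof.
move=> hk0 hmax m0 del.
have mR0 : 0 < m%:R :> R by rewrite ltr0n.
have d0 : (0 < d)%N by rewrite (leq_ltn_trans _ (ltn_ord k)).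
set H := absz (h 0 k).
have H0 : (0 < H)%N by rewrite absz_gt0.
(* The slot of coordinate [k] in the pigeonhole is given to [beta]; the coordinate [alpha 0 k] is
   recovered from the linear form. *)
pose x (i : 'I_d) := if i == k then beta else alpha 0 i.
pose S (q : nat) : int := p * q%:Z - \sum_(i | i != k) h 0 i * Num.floor (q%:R * x i).
have Slt q : (absz (S q %% h 0%R k)%Z < H)%N.
  by rewrite -ltz_nat !abszE ger0_norm ?modz_ge0 // ltz_mod.
pose key q : 'I_H := Ordinal (Slt q).
have [|q1 [q2 [/andP[q12 q2N] [keq] fl]]] :=
  @pigeonhole_fractional R 'I_d 'I_H x key m (m ^ d * H) m0.
  by rewrite !card_ord.
pose a i := Num.floor (q2%:R * x i) - Num.floor (q1%:R * x i).
set Q := (q2 - q1)%N in fl *.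
have Q0 : (0 < Q)%N by rewrite subn_gt0.
have QN : (Q <= m ^ d * H)%N by rewrite (leq_trans (leq_subr _ _)).
have [b hb] : exists b : int, p * Q%:Z - \sum_(i | i != k) h 0 i * a i = b * h 0 k.
  have eqm : (S q2 = S q1 %[mod h 0%R k])%Z.
    have : absz (S q2 %% h 0%R k)%Z = absz (S q1 %% h 0%R k)%Z by [].
    by move/(congr1 Posz); rewrite !abszE !ger0_norm ?modz_ge0.
  have /dvdzP[b eb] : (h 0%R k %| S q2 - S q1)%Z by rewrite -eqz_mod_dvd; apply/eqP.
  exists b; rewrite -eb /S.
  have -> : \sum_(i | i != k) h 0 i * a i =
     \sum_(i | i != k) h 0 i * Num.floor (q2%:R * x i) -
     \sum_(i | i != k) h 0 i * Num.floor (q1%:R * x i).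
    by rewrite -sumrB; apply: eq_bigr => i _; rewrite /a mulrBr.
  rewrite /Q -subzn ?(ltnW q12) //; ring.
have del0 : 0 <= (m ^ d)%:R * del by apply: mulr_ge0; [exact: ler0n|exact: normr_ge0].
exists Q; split.
- by rewrite Q0.
2: by exists (a k); have := fl k; rewrite /a /x eqxx.
move=> i; have [->{i}|ik] := eqVneq i k; last first.
  exists (a i); have := fl i; rewrite /a /x (negPf ik) => /lt_le_trans; apply.
  apply: (@le_trans _ _ (d%:R / m%:R)); last by rewrite lerDl.
  by rewrite -[leLHS]mul1r; apply: ler_wpM2r; rewrite ?ler1n // invr_ge0 ler0n.
exists b; set e := _ - _.
have hkR0 : 0 < `|(h 0 k)%:~R : R| by rewrite normr_gt0 intr_eq0.
have HR : `|(h 0 k)%:~R : R| = H%:R by rewrite -intr_norm -abszE.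
(* Multiply the linear form by [Q] and substitute [hb]. Since every coefficient is at most |h_k| in
   absolute value, dividing by h_k leaves d - 1 errors below 1/m and one of size at most m^d
   [del]. *)
have He : (h 0 k)%:~R * e = Q%:R * (\sum_j (h 0 j)%:~R * alpha 0 j - p%:~R)
   - \sum_(j | j != k) (h 0 j)%:~R * (Q%:R * x j - (a j)%:~R).
  have hbR : p%:~R * Q%:R - \sum_(i | i != k) (h 0 i)%:~R * (a i)%:~R
      = b%:~R * (h 0 k)%:~R :> R.
    have := congr1 (fun z : int => z%:~R : R) hb.
    rewrite intrB !intrM (rmorph_sum (intr : int -> R)) /= => <-.
    by congr (_ - _); apply: eq_bigr => j _; rewrite intrM.
  have -> : \sum_(j | j != k) (h 0 j)%:~R * (Q%:R * x j - (a j)%:~R) =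
     Q%:R * (\sum_(j | j != k) (h 0 j)%:~R * alpha 0 j) -
     \sum_(j | j != k) (h 0 j)%:~R * (a j)%:~R.
    rewrite mulr_sumr -sumrB; apply: eq_bigr => j /negPf jk.
    by rewrite /x jk; ring.
  rewrite (bigD1 k) //= /e mulrBr [_ * b%:~R]mulrC -hbR; ring.
rewrite -(ltr_pM2l hkR0) -normrM He.
apply: le_lt_trans (ler_normB _ _) _; rewrite normrM normr_nat -/del mulrDr addrC.
apply: ltr_leD.
  apply: le_lt_trans (ler_norm_sum _ _ _) _.
  have : \sum_(j | j != k) `|(h 0 j)%:~R * (Q%:R * x j - (a j)%:~R)|
     <= \sum_(j | j != k) `|(h 0 k)%:~R : R| * m%:R^-1.
    apply: ler_sum => j _; rewrite normrM; apply: ler_pM => //; last exact/ltW/fl.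
    by rewrite -!intr_norm ler_int.
  move/le_lt_trans; apply; rewrite sumr_const -mulrnAr ltr_pM2l //.
  rewrite -[ltLHS]mulr_natl ltr_pM2r ?invr_gt0 // ltr_nat.
  by rewrite (@eq_card _ _ (predC1 k)) // cardC1 card_ord ltn_predL.
rewrite HR mulrA -natrM; apply: ler_wpM2r; first exact: normr_ge0.
by rewrite ler_nat mulnC.
Qed.

Lemma unbounded_infinite_set (A : set nat) :
  (forall N, exists2 q, (N <= q)%N & A q) -> infinite_set A.
Proof.
move=> Aub /finite_seqP[s As].
have [q + Aq] := Aub (\max_(x <- s) x).+1.
by rewrite ltnNge leq_bigmax_seq //; move: Aq; rewrite As.
Qed.

Lemma infinite_set_int_vec_large (l : nat) (A : set 'rV[int]_l) (B : nat) :
  infinite_set A -> exists2 h, A h & exists i, (B < absz (h 0%R i))%N.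
Proof.
move=> Ainf; apply: contrapT => noh; apply: Ainf.
apply: sub_finite_set (@finite_int_vec_bounded l B) => h Ah i.
by rewrite leqNgt; apply/negP => hi; apply: noh; exists h => //; exists i.
Qed.

Lemma int_vec_norm_attained (R : realType) (l : nat) (h : 'rV[int]_l) (i0 : 'I_l) :
  exists k : 'I_l, (forall i, `|h 0 i| <= `|h 0 k|) /\
    `|map_mx intr h : 'rV[R]_l| = (absz (h 0%R k))%:R.
Proof.
case: (arg_maxnP (fun i => absz (h 0%R i)) (isT : xpredT i0)) => k _ kmax.
exists k; have hk i : `|h 0 i| <= `|h 0 k| by rewrite -!abszE lez_nat; exact: kmax.
have hR i : `|(map_mx intr h : 'rV[R]_l) 0 i| = (absz (h 0%R i))%:R.
  by rewrite mxE -intr_norm -abszE.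
split=> //; apply/eqP; rewrite eq_le; apply/andP; split.
  by apply/row_norm_leP => [|i]; rewrite ?hR ?ler_nat //; exact: kmax.
by have /row_norm_leP-/(_ (normr_ge0 _) k) := lexx `|map_mx intr h : 'rV[R]_l|; rewrite hR.
Qed.

Lemma ler1_powR_le (R : realType) (x t : R) : 1 <= x -> t <= 1 -> x `^ t <= x.
Proof. by move=> x1 t1; rewrite -[leRHS]powRr1 ?ler_powR // (le_trans ler01). Qed.

(** With m close to H^(tau/n), transference gives Q <= m^(n-1) H, at most 2 m^v for v = n - 1 +
    n/tau < n. Hence n/m beats Q^(-w) for any w < 1/v once m is large, and w can be taken above
    1/n. *)
Lemma line_point_good_approx (R : realType) (n : nat) (alpha : 'rV[R]_n.-1)
    (beta tau : R) : (2 <= n)%N -> n%:R < tau ->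
  infinite_set [set q : 'rV[int]_n.-1 | q != 0 /\
    dist_int (\sum_j (q 0 j)%:~R * alpha 0 j)
      < `|map_mx intr q : 'rV[R]_n.-1| `^ (- tau)] ->
  exists2 eps : R, 0 < eps & forall M : nat, exists m Q : nat,
    [/\ (M <= m)%N && (0 < m)%N, (0 < Q)%N,
      dist_int_vec (Q%:R *: line_point alpha beta) < n%:R / m%:R &
      n%:R / m%:R <= Q%:R `^ (- n%:R^-1 - eps)].
Proof.
move=> n2 ntau Ainf.
have nR2 : 2 <= n%:R :> R by rewrite (ler_nat _ 2).
have nR0 : 0 < n%:R :> R by lra.
have tau0 : 0 < tau by lra.
have dR : (n.-1)%:R = n%:R - 1 :> R by rewrite -subn1 natrB // ltnW.
set sg := tau / n%:R.
have sg1 : 1 < sg by rewrite ltr_pdivlMr // mul1r.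
have sgn : sg * n%:R = tau by rewrite /sg mulfVK ?gt_eqF.
have sg0 : 0 < sg by lra.
have isg1 : sg^-1 < 1 by rewrite invf_lt1 //; lra.
have isg0 : 0 < sg^-1 by rewrite invr_gt0; lra.
pose v := n.-1%:R + sg^-1.
have v1 : 1 < v by rewrite /v dR; lra.
have vn : v < n%:R by rewrite /v dR; lra.
pose w := (v^-1 + n%:R^-1) / 2.
have iv1 : v^-1 < 1 by rewrite invf_lt1 //; lra.
have ivn : n%:R^-1 < v^-1 by rewrite ltf_pV2 ?posrE //; lra.
have in0 : 0 < n%:R^-1 :> R by rewrite invr_gt0.
have w0 : 0 < w by rewrite /w; lra.
have w1 : w < 1 by rewrite /w; lra.
pose ka := 1 - v * w.
have vwE : v * w = (1 + v / n%:R) / 2 by rewrite /w; field; lra.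
have ka0 : 0 < ka.
  have : v / n%:R < 1 by rewrite ltr_pdivrMr // mul1r.
  by rewrite /ka vwE; lra.
exists (w - n%:R^-1); first by rewrite /w; lra.
move=> M.
(* The second summand ensures [2 * n%:R] <= m^[ka], which absorbs the constants at the end; doubling
   [M'] below makes up for the truncation in [m]. *)
pose M' := (M + Num.bound ((2 * n%:R : R) `^ ka^-1)).+1.
have [h [h0 hdist] [i Bi]] := @infinite_set_int_vec_large _ _ M'.*2 Ainf.
have [k [hk hn]] := @int_vec_norm_attained R _ h i.
have HM : (M'.*2 < absz (h 0%R k))%N.
  by rewrite (leq_trans Bi) // -lez_nat !abszE.
set H := absz (h 0%R k) in HM hn.
have HR1 : 1 <= H%:R :> R by rewrite ler1n (leq_ltn_trans _ HM).
have HR0 : 0 < H%:R :> R := lt_le_trans ltr01 HR1.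
have hk0 : h 0 k != 0 by rewrite -absz_gt0 (leq_ltn_trans _ HM).
move: hdist; rewrite hn => /dist_int_ltP[p hp].
pose m := Num.truncn (H%:R `^ sg : R).
have mle : m%:R <= H%:R `^ sg by rewrite truncn_le powR_ge0.
have mlt : H%:R `^ sg < m%:R + 1 by rewrite natr1; exact: Num.Theory.truncnS_gt.
have Hsg : H%:R <= H%:R `^ sg by rewrite -[leLHS](powRr1 (ltW HR0)) ler_powR // ltW.
have mM : (M' <= m)%N.
  rewrite -(ler_nat R).
  have : M'.*2%:R < H%:R :> R by rewrite ltr_nat.
  rewrite -addnn natrD => ?.
  have : 1 <= M'%:R :> R by rewrite ler1n.
  lra.
have m0 : (0 < m)%N by rewrite (leq_trans _ mM).
have mR1 : 1 <= m%:R :> R by rewrite ler1n.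
have mR0 : 0 < m%:R :> R := lt_le_trans ltr01 mR1.
have [Q [/andP[Q0 QN] aQ bQ]] :=
  @dual_to_simultaneous R _ alpha beta h k p m hk0 hk m0.
set del := `|_ - p%:~R| in hp aQ.
exists m, Q; split=> //.
- by rewrite m0 andbT (leq_trans _ mM) // /M' -addnS leq_addr.
(* This dictates the size of [m]: m^n <= H^tau, because [sg] * n = [tau]. *)
- have mdel : (m ^ n.-1)%:R * del < m%:R^-1.
    apply: (@lt_le_trans _ _ ((m ^ n.-1)%:R * H%:R `^ - tau)).
      by rewrite ltr_pM2l // ltr0n expn_gt0 m0.
    rewrite -[leRHS]mul1r ler_pdivlMr // mulrAC powRN ler_pdivrMr ?powR_gt0 // mul1r.
    rewrite -natrM mulnC -expnS prednK ?(ltnW n2) // natrX.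
    by rewrite -sgn powRrM powR_mulrn ?powR_ge0 // lerXn2r ?nnegrE ?powR_ge0 // ltW.
  have nm : n%:R / m%:R = n.-1%:R / m%:R + m%:R^-1 :> R by rewrite dR mulrBl mul1r subrK.
  apply/dist_line_point_ltP; [exact: ltnW|by rewrite divr_gt0|split].
    move=> j; have [z zlt] := aQ j; exists z; apply: lt_trans zlt _; by rewrite nm ltrD2l.
  have [z zlt] := bQ; exists z; apply: lt_le_trans zlt _.
  by rewrite nm lerDr divr_ge0.
have -> : - n%:R^-1 - (w - n%:R^-1) = - w by ring.
rewrite powRN -[leRHS]mul1r ler_pdivlMr ?powR_gt0 ?ltr0n // mulrAC ler_pdivrMr // mul1r.
have Hm : H%:R <= 2 * m%:R `^ sg^-1.
  have -> : H%:R = (H%:R `^ sg) `^ sg^-1 :> R.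
    by rewrite -powRrM divff ?gt_eqF // powRr1 // ltW.
  apply: (@le_trans _ _ ((2 * m%:R) `^ sg^-1)).
    apply: ge0_ler_powR; rewrite ?nnegrE ?powR_ge0 ?mulr_ge0 //; first exact: ltW.
    by apply: le_trans (ltW mlt) _; rewrite [2 * _]mulrDl mul1r lerD2l.
  rewrite powRM //; apply: ler_wpM2r; first exact: powR_ge0.
  by apply: ler1_powR_le; rewrite ?ler1n // ltW.
have Qm : Q%:R <= 2 * m%:R `^ v.
  apply: (@le_trans _ _ (m ^ n.-1 * H)%:R); first by rewrite ler_nat.
  rewrite /v powRD; last by rewrite (gt_eqF mR0) implybT.
  rewrite natrM natrX powR_mulrn ?ler0n // mulrCA; apply: ler_wpM2l => //.
have Qw : Q%:R `^ w <= 2 * m%:R `^ (v * w).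
  apply: (@le_trans _ _ ((2 * m%:R `^ v) `^ w)).
    by apply: (ge0_ler_powR (ltW w0)); rewrite ?nnegrE ?mulr_ge0 ?powR_ge0.
  rewrite powRM ?powR_ge0 // -powRrM; apply: ler_wpM2r; rewrite ?powR_ge0 //.
  by apply: ler1_powR_le; rewrite ?ler1n // ltW.
have mka : 2 * n%:R <= m%:R `^ ka.
  have -> : 2 * n%:R = ((2 * n%:R) `^ ka^-1) `^ ka :> R.
    by rewrite -powRrM mulVf ?powRr1 //; lra.
  apply: ge0_ler_powR; rewrite ?nnegrE ?powR_ge0 ?ltW //.
  apply: (@lt_le_trans _ _ (Num.bound ((2 * n%:R : R) `^ ka^-1))%:R).
    by apply: archi_boundP; rewrite powR_ge0.
  by rewrite ler_nat (leq_trans _ mM) // /M' -addSn leq_addl.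
have -> : m%:R = m%:R `^ ka * m%:R `^ (v * w).
  rewrite -powRD ?(gt_eqF mR0) ?implybT // /ka.
  by rewrite subrK powRr1.
apply: le_trans (ler_wpM2l (ltW nR0) Qw) _.
rewrite mulrA [n%:R * 2]mulrC; apply: ler_wpM2r; [exact: powR_ge0|exact: mka].
Qed.

(** Arbitrarily good approximations do not yet give infinitely many denominators. If some [Q] has
    distance 0, all its multiples serve; otherwise the distances over a finite set of denominators
    are bounded below, against n/m tending to 0. *)
Lemma coord_line_subset_VWA (R : realType) (n : nat) (alpha : 'rV[R]_n.-1) :
  (2 <= n)%N -> (n%:R%:E < dual_type alpha)%E ->
  @coord_line R n alpha `<=` @VWA R n.
Proof.
move=> n2 /ereal_sup_gt[_ [tau [tau0 Ainf] <-]]; rewrite lte_fin => ntau x [beta _ <-].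
have [eps eps0 good] := @line_point_good_approx R n alpha beta tau n2 ntau Ainf.
exists eps => //; set S := [set q : nat | _].
have nR0 : 0 < n%:R :> R by rewrite ltr0n ltnW.
have [[Q [Q0 distQ]]|/forallNP dpos] :=
  pselect (exists Q, (0 < Q)%N /\ dist_int_vec (Q%:R *: line_point alpha beta) <= 0).
  apply: unbounded_infinite_set => N; exists (N.+1 * Q)%N.
    by rewrite (leq_trans (leqnSn _)) // leq_pmulr.
  rewrite /S /= muln_gt0 Q0; split=> //.
  set t := _ `^ _; have t0 : 0 < t by rewrite powR_gt0 // ltr0n muln_gt0 Q0.
  have N0 : 0 < N.+1%:R :> R by rewrite ltr0n.
  apply/dist_int_vec_ltP => // i.
  have tN : 0 < t / N.+1%:R by rewrite divr_gt0.
  have /dist_int_vec_ltP-/(_ tN i)[z zlt] := le_lt_trans distQ tN.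
  exists (N.+1%:Z * z); move: zlt; rewrite !mxE ltr_pdivlMr // mulrC.
  rewrite -[X in X * `|_|](gtr0_norm N0) -normrM mulrBr intrM natrM.
  by rewrite mulrA.
move=> Sfin.
have [|c c0 cle] := @finite_set_pos_lbound R nat S
  (fun q => dist_int_vec (q%:R *: line_point alpha beta)) Sfin.
  by move=> q [q0 _]; rewrite ltNge; apply/negP => dq; apply: (dpos q).
have [m [Q [/andP[Mm m0] Q0 Qd Qe]]] := good (Num.bound (n%:R / c)).
have : c <= dist_int_vec (Q%:R *: line_point alpha beta).
  by apply: cle; split=> //; exact: lt_le_trans Qe.
rewrite leNgt => /negP; apply; apply: lt_le_trans Qd _.
rewrite ler_pdivrMr ?ltr0n // mulrC -ler_pdivrMr //.
apply: le_trans (_ : (Num.bound (n%:R / c))%:R <= _); last by rewrite ler_nat.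
by apply/ltW/archi_boundP; rewrite divr_ge0 ?ltW.
Qed.

(** * Counting good denominators *)

Lemma cosD_int_period (R : realType) (x : R) (z : int) :
  cos (2 * pi * (x - z%:~R)) = cos (2 * pi * x).
Proof.
have per := periodicn (@cosD2pi R).
case: z => k.
  rewrite -pmulrn -[in LHS](per k); congr cos.
  by rewrite -[_ *+ k]mulr_natr -mulr_natr; ring.
rewrite NegzE intrN opprK -pmulrn -[in RHS](per k.+1); congr cos.
by rewrite -[_ *+ k.+1]mulr_natr -mulr_natr; ring.
Qed.

(** The angle is at most pi/4 modulo the period, so its cosine c and the cosine 2 c^2 - 1 of its
    double are both nonnegative. *)
Lemma cos_ge_half (R : realType) (x : R) (z : int) :
  `|x - z%:~R| <= 8^-1 -> 2^-1 <= cos (2 * pi * x).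
Proof.
rewrite -(cosD_int_period x z); set y := x - _; rewrite ler_norml => /andP[y1 y2].
have pi0 := @pi_gt0 R.
have p1 : 0 <= pi * (y + 8^-1) by rewrite mulr_ge0 ?pi_ge0 //; lra.
have p2 : 0 <= pi * (8^-1 - y) by rewrite mulr_ge0 ?pi_ge0 //; lra.
have h1 : 0 <= cos (2 * pi * y) by apply: cos_ge0_pihalf; apply/andP; split; lra.
have : 0 <= cos ((2 * pi * y) *+ 2).
  by apply: cos_ge0_pihalf; rewrite [_ * y *+ 2]mulr2n; apply/andP; split; lra.
rewrite cos_mulr2n subr_ge0 [_ ^+ 2 *+ 2]mulr2n expr2 => h2; rewrite leNgt; apply/negP.
by move: (cos _) h1 h2 => {p1 p2 y1 y2} c c0 c1 c2; nra.
Qed.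

(** Multiplied by 2 sin (pi k / P), which is nonzero for 0 < k < P, the sum telescopes over a full
    period. *)
Lemma sum_cos_period (R : realType) (P k : nat) : (0 < k < P)%N ->
  \sum_(t < P) cos (2 * pi * (k%:R * t%:R / P%:R)) = 0 :> R.
Proof.
move=> /andP[k0 kP].
have PR0 : 0 < P%:R :> R by rewrite ltr0n (leq_trans _ kP).
have kR0 : 0 < k%:R :> R by rewrite ltr0n.
have kPR : k%:R < P%:R :> R by rewrite ltr_nat.
pose h : R := pi * k%:R / P%:R.
have sh : 0 < sin h.
  apply: sin_gt0_pi; rewrite divr_gt0 ?mulr_gt0 ?pi_gt0 //=.
  by rewrite ltr_pdivrMr // ltr_pM2l ?pi_gt0.
pose G (t : nat) : R := sin (2 * t%:R * h - h).
apply: (mulfI (lt0r_neq0 (mulr_gt0 (ltr0n R 2) sh))); rewrite mulr0 mulr_sumr.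
have GE t : 2 * sin h * cos (2 * pi * (k%:R * t%:R / P%:R)) = G t.+1 - G t.
  have -> : 2 * pi * (k%:R * t%:R / P%:R) = 2 * t%:R * h by rewrite /h; ring.
  have -> : G t.+1 = sin (2 * t%:R * h + h) by rewrite /G -natr1; congr sin; ring.
  by rewrite /G sinD sinB; ring.
rewrite (eq_bigr (fun t : 'I_P => G t.+1 - G t)) => [|t _]; last exact: GE.
rewrite -(big_mkord xpredT (fun t => G t.+1 - G t)) telescope_sumr // /G.
have -> : 2 * P%:R * h - h = - h + (pi *+ 2) *+ k.
  have hP : P%:R * h = pi * k%:R by rewrite /h mulrC mulfVK ?lt0r_neq0.
  by rewrite -mulrA hP -[_ *+ k]mulr_natr; ring.
by rewrite periodicn; [rewrite mulr0 mul0r sub0r subrr|exact: sinD2pi].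
Qed.

(** The product formula leaves the frequencies q - q' and q + q'. As 2 M < P, the second lies
    strictly between 0 and [P] and sums to 0, and the first does so unless it vanishes. *)
Lemma cos_orthogonal (R : realType) (P M q q' : nat) : (2 * M < P)%N ->
  (0 < q <= M)%N -> (0 < q' <= M)%N ->
  \sum_(t < P) cos (2 * pi * (q%:R * t%:R / P%:R)) * cos (2 * pi * (q'%:R * t%:R / P%:R))
   = if q == q' then P%:R / 2 else 0 :> R.
Proof.
move=> MP; wlog qq' : q q' / (q' <= q)%N.
  move=> wl Hq Hq'; have [le|/ltnW le] := leqP q' q; first exact: wl.
  by rewrite eq_sym -(wl q' q) //; apply: eq_bigr => t _; rewrite mulrC.
move=> /andP[q0 qM] /andP[q'0 q'M].
have cc t : cos (2 * pi * (q%:R * t%:R / P%:R)) * cos (2 * pi * (q'%:R * t%:R / P%:R))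
    = (cos (2 * pi * ((q - q')%N%:R * t%:R / P%:R))
     + cos (2 * pi * ((q + q')%N%:R * t%:R / P%:R))) / 2 :> R.
  rewrite natrB // natrD.
  rewrite [2 * pi * ((_ - _) * _ / _)](_ : _ = 2 * pi * (q%:R * t%:R / P%:R)
    - 2 * pi * (q'%:R * t%:R / P%:R)); last by ring.
  rewrite [2 * pi * ((_ + _) * _ / _)](_ : _ = 2 * pi * (q%:R * t%:R / P%:R)
    + 2 * pi * (q'%:R * t%:R / P%:R)); last by ring.
  by rewrite cosB cosD; field.
rewrite (eq_bigr (fun t : 'I_P => (cos (2 * pi * ((q - q')%N%:R * t%:R / P%:R))
     + cos (2 * pi * ((q + q')%N%:R * t%:R / P%:R))) / 2)) => [|t _]; last exact: cc.
rewrite -mulr_suml big_split /= (@sum_cos_period _ P (q + q')) ?addr0; last by lia.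
have [->|neq] := eqVneq q q'.
  rewrite subnn (eq_bigr (fun=> 1)) => [|t _]; last by rewrite !mul0r mulr0 cos0.
  by rewrite sumr_const card_ord.
by rewrite sum_cos_period ?mul0r //; lia.
Qed.

(* The mean square of [\sum_(q <- s) cos (2 pi q t / P)] over [t] modulo [P] is
   [size s / 2], while the sum is at least [size s / 2] at each [t = f j]. *)
Lemma cos_large_sieve (R : realType) (J : finType) (P M : nat) (s : seq nat)
    (f : J -> 'I_P) : (2 * M < P)%N -> uniq s ->
  {in s, forall q, (0 < q <= M)%N} -> injective f ->
  {in s, forall q, forall j, (2^-1 : R) <= cos (2 * pi * (q%:R * (f j)%:R / P%:R))} ->
  (size s * #|J| <= 2 * P)%N.
Proof.
move=> MP us sM finj fcos.
have [s0|s0] := posnP (size s); first by rewrite s0.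
have sR0 : 0 < (size s)%:R :> R by rewrite ltr0n.
pose C (t : 'I_P) : R := \sum_(q <- s) cos (2 * pi * (q%:R * t%:R / P%:R)).
have Csq : \sum_(t < P) C t ^+ 2 = (size s)%:R * (P%:R / 2).
  transitivity (\sum_(t < P) \sum_(q <- s) \sum_(q' <- s)
    cos (2 * pi * (q%:R * t%:R / P%:R)) * cos (2 * pi * (q'%:R * t%:R / P%:R)) : R).
    apply: eq_bigr => t _; rewrite expr2 /C mulr_suml; apply: eq_bigr => q _.
    by rewrite mulr_sumr.
  rewrite exchange_big /= big_seq.
  rewrite (eq_bigr (fun=> P%:R / 2)) => [|q qs].
    by rewrite -big_seq big_const_seq count_predT iter_addr_0 [RHS]mulr_natl.
  rewrite exchange_big /= (bigD1_seq q) //= (@cos_orthogonal R _ _ _ _ MP) ?sM // eqxx.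
  rewrite big_seq_cond big1 ?addr0 // => q' /andP[q's q'q].
  by rewrite (@cos_orthogonal R _ _ _ _ MP) ?sM // eq_sym (negPf q'q).
(* Only the residues in the image of [f] are retained; injectivity makes them [#|J|] distinct
   terms. *)
have Cge : #|J|%:R * ((size s)%:R / 2) ^+ 2 <= \sum_(t < P) C t ^+ 2.
  rewrite (bigID [in codom f]) /= -[leLHS]addr0; apply: lerD; last first.
    by apply: sumr_ge0 => t _; rewrite sqr_ge0.
  have -> : \sum_(t in codom f) C t ^+ 2 = \sum_(j : J) C (f j) ^+ 2.
    rewrite -big_uniq /=; last by rewrite map_inj_uniq ?enum_uniq.
    by rewrite big_image.
  rewrite mulr_natl.
  rewrite -sumr_const.
  apply: ler_sum => j _; rewrite lerXn2r ?nnegrE ?divr_ge0 //.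
    by rewrite /C big_seq sumr_ge0 // => q qs; apply: le_trans (fcos q qs j); rewrite invr_ge0.
  rewrite /C big_seq (@le_trans _ _ (\sum_(q <- s | q \in s) 2^-1)) //.
    by rewrite -big_seq big_const_seq count_predT iter_addr_0 mulr_natl.
  by apply: ler_sum => q qs; exact: fcos.
rewrite -(ler_nat R) !natrM -(ler_pM2l sR0).
move: Cge; rewrite Csq; lra.
Qed.

(** The Bohr set of [alpha] of radius [del], as a boolean predicate so that it can be counted and
    filtered. *)
Definition bohr (R : realType) (d : nat) (alpha : 'rV[R]_d) (del : R) : pred nat :=
  fun q => `[< forall i, exists z : int, `|q%:R * alpha 0 i - z%:~R| < del >].

(* The separated points [j.alpha], [0 <= j_i < H], round to distinct residues
   modulo [P = 16 M], and every [q] counted here makes all the corresponding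
   cosines large. *)
Lemma count_bohr (R : realType) (d : nat) (alpha : 'rV[R]_d) (H M : nat) :
  (0 < d)%N -> (0 < H)%N -> (0 < M)%N ->
  (forall h : 'rV[int]_d, h != 0 -> (forall i, absz (h 0%R i) < H)%N ->
     forall z : int, (16 * M%:R)^-1 <= `|\sum_j (h 0 j)%:~R * alpha 0 j - z%:~R|) ->
  (count (bohr alpha (16 * d%:R * H%:R)^-1) (iota 1 M) * H ^ d <= 32 * M)%N.
Proof.
move=> d0 H0 M0 sep.
have dR0 : 0 < d%:R :> R by rewrite ltr0n.
have HR0 : 0 < H%:R :> R by rewrite ltr0n.
have MR0 : 0 < M%:R :> R by rewrite ltr0n.
pose P := (16 * M)%N; have P0 : (0 < P)%N by rewrite muln_gt0.
have PR0 : 0 < P%:R :> R by rewrite ltr0n.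
have PRE : P%:R = 16 * M%:R :> R by rewrite natrM.
pose J : finType := {ffun 'I_d -> 'I_H}.
pose y (j : J) : R := \sum_i (j i)%:R * alpha 0 i.
pose fl (j : J) : int := Num.floor (P%:R * y j).
have flt j : (absz (fl j %% P%:Z)%Z < P)%N.
  by rewrite -ltz_nat !abszE ger0_norm ?modz_ge0 ?ltz_pmod // -?lt0n // gt_eqF.
pose f j : 'I_P := Ordinal (flt j).
have fE j : (f j)%:Z = (fl j %% P%:Z)%Z.
  by rewrite /= abszE ger0_norm ?modz_ge0 // gt_eqF.
have fd j : exists w : int, 0 <= P%:R * y j - (f j)%:R - P%:R * w%:~R < 1.
  exists (fl j %/ P%:Z)%Z.
  have -> : P%:R * y j - (f j)%:R - P%:R * (fl j %/ P%:Z)%Z%:~R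
      = P%:R * y j - (fl j)%:~R :> R.
    rewrite [in RHS](divz_eq (fl j) P%:Z) intrD intrM -fE; ring.
  by rewrite subr_ge0 floor_le ltrBlDl -[X in _ + X]/(1%:~R) -intrD floorD1_gt.
set s := [seq q <- iota 1 M | bohr alpha (16 * d%:R * H%:R)^-1 q].
have sM : {in s, forall q, (0 < q <= M)%N}.
  by move=> q; rewrite mem_filter mem_iota => /andP[_]; rewrite add1n ltnS.
rewrite -size_filter -/s.
have -> : (H ^ d = #|J|)%N by rewrite card_ffun !card_ord.
have -> : (32 * M = 2 * P)%N by rewrite /P; lia.
apply: (@cos_large_sieve R J P M s f); rewrite ?filter_uniq ?iota_uniq //.
- by rewrite /P; lia.
- move=> j j' ff; apply/eqP/negPn/negP => jj'.
  pose h : 'rV[int]_d := \row_i ((j i)%:Z - (j' i)%:Z).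
  have h0 : h != 0.
    apply: contra_neq jj' => /rowP h0; apply/ffunP => i; apply: val_inj => /=.
    by have /eqP := h0 i; rewrite !mxE subr_eq0 => /eqP[].
  have hH i : (absz (h 0%R i) < H)%N.
    rewrite mxE; move: (ltn_ord (j i)) (ltn_ord (j' i)).
    by move: (nat_of_ord (j i)) (nat_of_ord (j' i)) => {h h0} a b; lia.
  have hy : \sum_i (h 0 i)%:~R * alpha 0 i = y j - y j'.
    by rewrite /y -sumrB; apply: eq_bigr => i _; rewrite mxE intrB mulrBl.
  have [w /andP[w0 w1]] := fd j; have [w' /andP[w'0 w'1]] := fd j'.
  (* Equal residues put [y j - y j'] strictly within 1/P of the integer [w - w'], against the
     separation. *)
  have := sep h h0 hH (w - w'); rewrite hy leNgt => /negP; apply.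
  rewrite -PRE -[_^-1]mul1r ltr_pdivlMr // -[X in _ * X](gtr0_norm PR0) -normrM.
  rewrite -ff in w'0 w'1; rewrite intrB ltr_norml; apply/andP; split; lra.
move=> q qs j.
have /andP[q0 qM] := sM q qs.
move: qs; rewrite mem_filter => /andP[/asboolP/choice[z qz] _].
have [w /andP[w0 w1]] := fd j.
(* The admissible error 1/8 is split in two: 1/16 for the [d] terms of the form [y j], and q/P <=
   1/16 for rounding to the residue [f j]. *)
apply: (@cos_ge_half _ _ (\sum_i (j i)%:Z * z i - q%:Z * w)).
have qy : `|q%:R * y j - (\sum_i (j i)%:Z * z i)%:~R| <= 16^-1.
  rewrite (rmorph_sum (intr : int -> R)) /= /y mulr_sumr -sumrB.
  apply: le_trans (ler_norm_sum _ _ _) _.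
  apply: (@le_trans _ _ (\sum_(i < d) (16 * d%:R)^-1)); last first.
    by rewrite sumr_const card_ord -[leLHS]mulr_natr invfM -mulrA mulVf ?mulr1 // lt0r_neq0.
  apply: ler_sum => i _.
  have -> : q%:R * ((j i)%:R * alpha 0 i) - ((j i)%:Z * z i)%:~R
      = (j i)%:R * (q%:R * alpha 0 i - (z i)%:~R) by rewrite intrM; ring.
  rewrite normrM normr_nat [leRHS](_ : _ = H%:R * (16 * d%:R * H%:R)^-1); last first.
    by field; rewrite !lt0r_neq0.
  by apply: ler_pM => //; [rewrite ler_nat ltnW|exact: ltW].
have qM' : q%:R / P%:R <= 16^-1 :> R.
  by rewrite ler_pdivrMr // PRE mulrA mulVf // mul1r ler_nat.
have qR0 : 0 <= q%:R / P%:R :> R by rewrite divr_ge0.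
have E : q%:R * (f j)%:R / P%:R - (\sum_i (j i)%:Z * z i - q%:Z * w)%:~R
  = (q%:R * y j - (\sum_i (j i)%:Z * z i)%:~R)
    - q%:R / P%:R * (P%:R * y j - (f j)%:R - P%:R * w%:~R).
  by rewrite intrB intrM; field; exact: lt0r_neq0.
rewrite E; apply: le_trans (ler_normB _ _) _.
have : `|q%:R / P%:R * (P%:R * y j - (f j)%:R - P%:R * w%:~R)| <= 16^-1.
  by rewrite normrM !ger0_norm //; apply: le_trans qM'; rewrite ler_piMr // ltW.
by move=> ?; lra.
Qed.

(** For [tau] above the dual type only finitely many [h] violate the bound with constant 1, and [c]
    is the least of 1 and the finitely many remaining ratios. *)
Lemma dual_type_lt_separation (R : realType) (n : nat) (alpha : 'rV[R]_n.-1) :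
  (2 <= n)%N -> (dual_type alpha < n%:R%:E)%E ->
  exists tau c : R, [/\ 1 <= tau, tau < n%:R, 0 < c &
    forall (h : 'rV[int]_n.-1) (z : int), h != 0 ->
      c * `|map_mx intr h : 'rV[R]_n.-1| `^ (- tau)
        <= `|\sum_j (h 0 j)%:~R * alpha 0 j - z%:~R|].
Proof.
move=> n2 typen.
have nR2 : 2 <= n%:R :> R by rewrite (ler_nat _ 2).
have [tau [tau1 taun typetau]] : exists tau : R,
    [/\ 1 <= tau, tau < n%:R & (dual_type alpha < tau%:E)%E].
  move: typen; case: (dual_type alpha) => [D| |] //; last first.
    by move=> _; exists 1; split=> //; [lra|exact: ltNyr].
  rewrite lte_fin => Dn; exists ((Num.max D 1 + n%:R) / 2).
  have D1 : D <= Num.max D 1 by rewrite le_max lexx.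
  have D2 : 1 <= Num.max D 1 by rewrite le_max lexx orbT.
  have D3 : Num.max D 1 < n%:R by rewrite gt_max Dn; lra.
  by split; rewrite ?lte_fin; lra.
have tau0 : 0 < tau by lra.
set X := [set q : 'rV[int]_n.-1 | q != 0 /\
      dist_int (\sum_j (q 0 j)%:~R * alpha 0 j)
        < `|map_mx intr q : 'rV[R]_n.-1| `^ (- tau)].
have Xfin : finite_set X.
  apply: contrapT => Xinf; move: typetau; rewrite ltNge => /negP; apply.
  by apply: ereal_sup_ubound; exists tau.
have hN (h : 'rV[int]_n.-1) : h != 0 -> 0 < `|map_mx intr h : 'rV[R]_n.-1|.
  move=> h0; rewrite normr_gt0; apply: contra_neq h0 => /rowP h0; apply/rowP => i.
  by have /eqP := h0 i; rewrite !mxE intr_eq0 => /eqP.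
pose g (h : 'rV[int]_n.-1) : R := dist_int (\sum_j (h 0 j)%:~R * alpha 0 j)
  * `|map_mx intr h : 'rV[R]_n.-1| `^ tau.
have gpos h : X h -> 0 < g h.
  move=> [h0 _]; rewrite mulr_gt0 ?powR_gt0 ?hN // ltNge; apply/negP => dist0.
  have [i0 hi0] : exists i, h 0 i != 0.
    apply: contrapT => /forallNP hi; move/eqP: h0; apply; apply/rowP => i.
    by rewrite mxE; apply/eqP/negPn/negP/hi.
  (* A zero distance would persist at every multiple of [h], while the multiples grow in norm only:
     infinitely many exceptions would result. *)
  have multX k : X (k.+1%:Z *: h).
    have kh0 : k.+1%:Z *: h != 0.
      apply/negP => /eqP/rowP/(_ i0)/eqP.
      by rewrite !mxE mulf_eq0 (negPf hi0) orbF.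
    split=> //; set t := _ `^ _; have t0 : 0 < t by rewrite powR_gt0 ?hN.
    have k0 : 0 < k.+1%:R :> R by rewrite ltr0n.
    have tk : 0 < t / k.+1%:R by rewrite divr_gt0.
    have /dist_int_ltP[z zlt] := le_lt_trans dist0 tk.
    apply/dist_int_ltP; exists (k.+1%:Z * z); move: zlt; rewrite ltr_pdivlMr // mulrC.
    rewrite -[X in X * `|_|](gtr0_norm k0) -normrM mulrBr intrM mulr_sumr.
    suff -> : \sum_j ((k.+1%:Z *: h) 0 j)%:~R * alpha 0 j
      = \sum_j k.+1%:R * ((h 0 j)%:~R * alpha 0 j) by [].
    by apply: eq_bigr => j _; rewrite mxE intrM mulrA.
  apply: infinite_nat.
  rewrite (_ : [set: nat] = (fun k => k.+1%:Z *: h) @^-1` X); last first.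
    by apply/seteqP; split=> // k _; exact: multX.
  apply: finite_preimage => // k k' _ _ /rowP kk'.
  by have := kk' i0; rewrite !mxE => /(mulIf hi0) [].
have [c c0 cle] := finite_set_pos_lbound Xfin gpos.
exists tau, (Num.min c 1); split=> //; first by rewrite lt_min c0 /=.
move=> h z h0; have hp := hN h h0.
rewrite powRN ler_pdivrMr ?powR_gt0 //.
have [Xh|nXh] := pselect (X h).
  rewrite ge_min; apply/orP; left; apply: le_trans (cle h Xh) _.
  rewrite ler_wpM2r ?powR_ge0 // leNgt; apply/negP => dlt.
  suff : dist_int (\sum_j (h 0 j)%:~R * alpha 0 j) < dist_int (\sum_j (h 0 j)%:~R * alpha 0 j).
    by rewrite ltxx.
  by apply/dist_int_ltP; exists z.
rewrite ge_min; apply/orP; right; rewrite leNgt; apply/negP => dlt; apply: nXh.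
split=> //; apply/dist_int_ltP; exists z.
by rewrite powRN -[X in _ < X]mul1r ltr_pdivlMr ?powR_gt0.
Qed.

(** Take [H] to be 1/(16 d del) rounded down, which loses at most a factor 2. The separation of the
    points is then at least c del^tau >= 1/(16 M), and [count_bohr] applies. *)
Lemma count_bohr_le (R : realType) (d : nat) (alpha : 'rV[R]_d) (tau c : R) :
  (0 < d)%N -> 0 < tau -> 0 < c ->
  (forall (h : 'rV[int]_d) (z : int), h != 0 ->
      c * `|map_mx intr h : 'rV[R]_d| `^ (- tau)
        <= `|\sum_j (h 0 j)%:~R * alpha 0 j - z%:~R|) ->
  forall (M : nat) (del : R), (0 < M)%N -> 0 < del -> 16 * d%:R * del <= 1 ->
    del^-1 `^ tau <= 16 * c * M%:R ->
    (count (bohr alpha del) (iota 1 M))%:R <= 32 * (32 * d%:R) ^+ d * (del ^+ d * M%:R).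
Proof.
move=> d0 tau0 c0 sep M del M0 del0 del1 delM.
have dR0 : 0 < d%:R :> R by rewrite ltr0n.
have dR1 : 1 <= d%:R :> R by rewrite ler1n.
have MR0 : 0 < M%:R :> R by rewrite ltr0n.
have dd0 : 0 < 16 * d%:R * del by rewrite !mulr_gt0.
set H := Num.truncn ((16 * d%:R * del)^-1).
have H0 : (0 < H)%N by rewrite truncn_gt0 -[leLHS]invr1 lef_pV2 // posrE.
have HR1 : 1 <= H%:R :> R by rewrite ler1n.
have HR0 : 0 < H%:R :> R by rewrite ltr0n.
have Hle : H%:R * (16 * d%:R * del) <= 1.
  by rewrite -ler_pdivlMr // mul1r truncn_le invr_ge0 ltW.
have Hgt : 1 <= 32 * d%:R * del * H%:R.
  have : (16 * d%:R * del)^-1 < H%:R + 1 by rewrite natr1; exact: Num.Theory.truncnS_gt.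
  rewrite -[_^-1]mul1r ltr_pdivrMr // => h1; nra.
have cnt : (count (bohr alpha (16 * d%:R * H%:R)^-1) (iota 1 M) * H ^ d <= 32 * M)%N.
  apply: count_bohr => // h h0 hH z; apply: le_trans (sep h z h0).
  rewrite powRN ler_pdivlMr; last first.
    rewrite powR_gt0 // normr_gt0; apply: contra_neq h0 => /rowP h0; apply/rowP => i.
    by have /eqP := h0 i; rewrite !mxE intr_eq0 => /eqP.
  rewrite mulrC ler_pdivrMr ?mulr_gt0 // mulrA [c * 16]mulrC; apply: le_trans delM.
  apply: (ge0_ler_powR (ltW tau0)); rewrite ?nnegrE ?invr_ge0 ?(ltW del0) //; apply: (@le_trans _ _ H%:R).
    apply/row_norm_leP => [|i]; first exact: ltW.
    by rewrite mxE -intr_norm -abszE ler_nat ltnW.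
  rewrite -[leRHS]mul1r ler_pdivlMr //; nra.
have sub : (count (bohr alpha del) (iota 1 M) <=
            count (bohr alpha (16 * d%:R * H%:R)^-1) (iota 1 M))%N.
  apply: sub_count => q /asboolP qdel; apply/asboolP => i; have [z zlt] := qdel i.
  exists z; apply: lt_le_trans zlt _.
  by rewrite -[leRHS]mul1r ler_pdivlMr ?mulr_gt0 //; lra.
move: cnt; rewrite -(ler_nat R) !natrM natrX => cnt.
have HD : 1 <= (32 * d%:R * del) ^+ d * H%:R ^+ d by rewrite -exprMn exprn_ege1.
apply: (@le_trans _ _ ((count (bohr alpha (16 * d%:R * H%:R)^-1) (iota 1 M))%:R
    * ((32 * d%:R * del) ^+ d * H%:R ^+ d))).
  apply: le_trans (_ : (count (bohr alpha (16 * d%:R * H%:R)^-1) (iota 1 M))%:R <= _).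
    by rewrite ler_nat.
  by rewrite ler_peMr.
rewrite mulrCA mulrC mulrA.
apply: le_trans (ler_wpM2r _ cnt) _.
  by rewrite exprn_ge0 // !mulr_ge0 // ltW.
by rewrite exprMn le_eqVlt; apply/orP; left; apply/eqP; ring.
Qed.

(** * Regular scales *)

(** For nonnegative [mu] this is the maximum of mu^(l-k) e_k over k <= l. *)
Fixpoint envelope (R : realType) (e : nat -> R) (mu : R) (l : nat) : R :=
  if l is k.+1 then Num.max (e k.+1) (mu * envelope e mu k) else e 0%N.

(* The indices at which [e] has not dropped below a geometric decay of ratio [mu]
   from any earlier value. *)
Definition kept (R : realType) (e : nat -> R) (mu : R) : pred nat :=
  fun l => envelope e mu l == e l.

Lemma envelope_ge (R : realType) (e : nat -> R) (mu : R) (l : nat) :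
  e l <= envelope e mu l.
Proof. by case: l => [|l] //=; rewrite le_max lexx. Qed.

Lemma envelope_decay (R : realType) (e : nat -> R) (mu : R) (k l : nat) :
  0 <= mu -> (k <= l)%N -> mu ^+ (l - k) * envelope e mu k <= envelope e mu l.
Proof.
move=> mu0 kl; rewrite -{2}(subnK kl); elim: (l - k)%N => [|j IHj]; first by rewrite mul1r.
rewrite addSn /= le_max exprS -mulrA; apply/orP; right; exact: ler_wpM2l.
Qed.

Lemma kept_decay (R : realType) (e : nat -> R) (mu : R) (k l : nat) :
  0 <= mu -> (k <= l)%N -> kept e mu l -> mu ^+ (l - k) * e k <= e l.
Proof.
move=> mu0 kl /eqP <-; apply: le_trans (envelope_decay e mu0 kl).
by apply: ler_wpM2l; [rewrite exprn_ge0|exact: envelope_ge].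
Qed.

(* Geometric decay forces a fixed proportion of the sum onto the kept indices. *)
Lemma sum_kept_ge (R : realType) (e : nat -> R) (mu : R) (n m : nat) :
  (forall k, 0 <= e k) -> 0 <= mu <= 1 ->
  (1 - mu ^+ n) * \sum_(l < m) e l ^+ n <= \sum_(l < m | kept e mu l) e l ^+ n.
Proof.
move=> e0 /andP[mu0 mu1].
have g0 k : 0 <= envelope e mu k by apply: le_trans (envelope_ge e mu k).
have la0 : 0 <= mu ^+ n by rewrite exprn_ge0.
have la1 : mu ^+ n <= 1 by rewrite exprn_ile1.
case: m => [|m]; first by rewrite !big_ord0 mulr0.
(* The extra term makes the induction work: at an index that is not kept the envelope is exactly
   multiplied by [mu], so the term of the previous index pays for the new one. *)
apply: (@le_trans _ _ ((1 - mu ^+ n) * \sum_(l < m.+1) envelope e mu l ^+ n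
    + mu ^+ n * envelope e mu m ^+ n)).
  rewrite -[leLHS]addr0; apply: lerD; last by rewrite mulr_ge0 ?exprn_ge0.
  apply: ler_wpM2l; first by rewrite subr_ge0.
  by apply: ler_sum => l _; rewrite lerXn2r ?nnegrE // envelope_ge.
elim: m => [|m IHm].
  have k0 : kept e mu 0 by rewrite /kept eqxx.
  by rewrite [leRHS]big_mkcond !big_ord_recl !big_ord0 /= k0 !addr0 -mulrDl subrK mul1r lexx.
rewrite [leRHS]big_mkcond [leRHS]big_ord_recr -big_mkcond [in leLHS]big_ord_recr /= -/(envelope e mu m.+1).
rewrite mulrDr -addrA -[X in _ + X]mulrDl subrK mul1r.
set g := envelope e mu m in IHm *.
have kE : (Num.max (e m.+1) (mu * g) == e m.+1) = (mu * g <= e m.+1).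
  by apply/eqP/idP => [<-|le]; [rewrite le_max lexx orbT|apply/max_idPl].
rewrite /kept /= -/g kE; case: ifPn => [le|]; last first.
  rewrite -ltNge => lt; rewrite (max_idPr (ltW lt)) addr0 exprMn; exact: IHm.
rewrite (max_idPl le) lerD2r; apply: le_trans IHm.
by rewrite lerDl mulr_ge0 ?exprn_ge0 //; exact: g0.
Qed.

(** Infinitely many terms at least 1 would make the truncated sums unbounded, so from some index on
    the truncation has no effect. *)
Lemma bounded_of_min1_bounded (R : realType) (u : nat -> R) (C : R) :
  (forall k, 0 <= u k) -> (forall m, \sum_(l < m) Num.min 1 (u l) <= C) ->
  exists D, forall m, \sum_(l < m) u l <= D.
Proof.
move=> u0 uC.
have min0 k : 0 <= Num.min 1 (u k) by rewrite le_min ler01 u0.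
have [L uL] : exists L, forall l, (L <= l)%N -> u l < 1.
  apply: contrapT => /forallNP noL.
  suff ub N : exists m, N%:R <= \sum_(l < m) Num.min 1 (u l).
    have C0 : 0 <= C by apply: le_trans (uC 0%N); rewrite big_ord0.
    have [m mN] := ub (Num.bound C).
    by have := le_lt_trans (le_trans mN (uC m)) (archi_boundP C0); rewrite ltxx.
  elim: N => [|N [m IH]]; first by exists 0%N; rewrite big_ord0.
  have /existsNP[l /not_implyP[ml /negP]] := noL m; rewrite -leNgt => ul.
  exists l.+1; rewrite big_ord_recr /= (min_idPl ul) -natr1 lerD2r.
  apply: le_trans IH _; rewrite -(subnKC ml) big_split_ord /= lerDl.
  exact: sumr_ge0.
exists (\sum_(l < L) u l + C) => m.
have [mL|Lm] := leqP m L.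
  rewrite -(subnKC mL) big_split_ord /= -addrA lerDl addr_ge0 ?sumr_ge0 //.
  by apply: le_trans (uC 0%N); rewrite big_ord0.
have := uC m; rewrite -(subnKC (ltnW Lm)) !big_split_ord /= => uCm.
rewrite lerD2l; apply: le_trans uCm; rewrite -[leLHS]add0r lerD ?sumr_ge0 //.
by apply: ler_sum => l _; rewrite le_min lexx ltW // uL // leq_addr.
Qed.

(** Cauchy condensation in base [B]: the block from B^m to B^(m+1) has at most B^(m+1) terms, each
    at most the first. *)
Lemma condensation_bound (R : realType) (psi : R -> R) (n B : nat) (D : R) :
  approximating_function psi -> (2 <= B)%N ->
  (forall m, \sum_(l < m) (B ^ l)%:R * psi (B ^ l)%:R ^+ n <= D) ->
  (\sum_(1 <= q <oo) (psi q%:R ^+ n)%:E < +oo)%E.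
Proof.
move=> [psi0 psid] B2 uD.
have B0 l : (0 < B ^ l)%N by rewrite expn_gt0 ltnW.
have pp q : (0 < q)%N -> 0 <= psi q%:R ^+ n by move=> q0; rewrite exprn_ge0 // ltW // psi0 // ltr0n.
have bound m : \sum_(1 <= q < B ^ m) psi q%:R ^+ n
    <= B%:R * \sum_(l < m) (B ^ l)%:R * psi (B ^ l)%:R ^+ n.
  elim: m => [|m IHm]; first by rewrite expn0 big_geq // big_ord0 mulr0.
  rewrite (big_cat_nat (n := B ^ m)) ?leq_exp2l //= big_ord_recr /= mulrDr lerD //.
  apply: (@le_trans _ _ (\sum_(B ^ m <= q < B ^ m.+1) psi (B ^ m)%:R ^+ n)).
    rewrite !big_nat; apply: ler_sum => q /andP[q1 q2].
    have q0 : (0 < q)%N by rewrite (leq_trans _ q1).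
    apply: lerXn2r; rewrite ?nnegrE; first by rewrite ltW ?psi0 ?ltr0n.
      by rewrite ltW ?psi0 ?ltr0n.
    by apply: psid; rewrite ?ltr0n ?ler_nat.
  rewrite sumr_const_nat -[leLHS]mulr_natl mulrA -natrM -expnS.
  by rewrite ler_wpM2r ?pp // ler_nat leq_subr.
apply: (@le_lt_trans _ _ (B%:R * D)%:E); last exact: ltry.
apply: lime_le.
  by apply: is_cvg_nneseries => q q1 _; rewrite lee_fin pp.
apply: nearW => N; rewrite sumEFin lee_fin.
apply: (@le_trans _ _ (\sum_(1 <= q < B ^ N.+1) psi q%:R ^+ n)).
  have NB : (N <= B ^ N.+1)%N by rewrite ltnW // (leq_trans _ (ltnW (ltn_expl N.+1 B2))).
  have [N1|N1] := leqP N 1; first by rewrite big_geq // big_nat sumr_ge0 // => q /andP[q1 _]; exact: pp.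
  rewrite [leRHS](big_cat_nat (n := N)) ?(ltnW N1) //= lerDl big_nat sumr_ge0 // => q /andP[q1 _].
  by rewrite pp // (leq_trans _ q1) // ltnW.
by apply: le_trans (bound _) _; rewrite ler_wpM2l.
Qed.

(** The power [e k ^+ n] is the condensed term truncated at 1. Bounded kept sums would bound all
    truncated sums, then the condensed sums, and finally the series itself. *)
Lemma kept_sums_diverge (R : realType) (psi : R -> R) (n b : nat) (mu C : R) :
  approximating_function psi -> (0 < n)%N -> (2 <= b)%N -> 0 <= mu < 1 ->
  (\sum_(1 <= q <oo) (psi q%:R ^+ n)%:E)%E = +oo%E ->
  let e k := Num.min 1 (b%:R ^+ k * psi ((b ^ n) ^ k)%:R) in
  exists m, C < \sum_(l < m | kept e mu l) e l ^+ n.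
Proof.
move=> psiA n0 b2 /andP[mu0 mu1] psioo e; apply: contrapT => /forallNP noC.
have [psi0 psid] := psiA.
have bn2 : (2 <= b ^ n)%N by rewrite (leq_trans b2) // -[leqLHS]expn1 leq_exp2l.
have w0 k : 0 < b%:R ^+ k * psi ((b ^ n) ^ k)%:R :> R.
  by rewrite mulr_gt0 ?exprn_gt0 ?psi0 ?ltr0n ?expn_gt0 ?(ltnW b2) // (ltnW bn2).
have e0 k : 0 <= e k by rewrite le_min ler01 ltW.
have mun : mu ^+ n < 1 by rewrite exprn_ilt1 -?lt0n.
have eC m : \sum_(l < m) e l ^+ n <= C / (1 - mu ^+ n).
  rewrite ler_pdivlMr ?subr_gt0 // mulrC.
  apply: le_trans (sum_kept_ge n m e0 _) _; first by rewrite mu0 ltW.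
  by rewrite leNgt; apply/negP; exact: noC.
pose u l : R := ((b ^ n) ^ l)%:R * psi ((b ^ n) ^ l)%:R ^+ n.
have uE l : u l = (b%:R ^+ l * psi ((b ^ n) ^ l)%:R) ^+ n.
  by rewrite /u exprMn -exprM -expnM mulnC natrX.
have eu l : e l ^+ n = Num.min 1 (u l).
  rewrite /e uE; have [le|lt] := leP 1 (b%:R ^+ l * _).
    by rewrite expr1n; apply/esym/min_idPl/exprn_ege1.
  by apply/esym/min_idPr/exprn_ile1; rewrite ltW.
have [||D uD] := @bounded_of_min1_bounded R u (C / (1 - mu ^+ n)).
- by move=> k; rewrite uE exprn_ge0 // ltW.
- by move=> m; under eq_bigr do rewrite -eu; exact: eC.
by have := condensation_bound psiA bn2 uD; rewrite psioo ltxx.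
Qed.

(** * Ubiquity *)

(** Pigeonhole with about 1/del cells for each coordinate of [alpha] and M = N / m^d cells for
    [beta]. The constant collects the two roundings, m del <= 2 and N <= 2 M m^d. *)
Lemma dirichlet_line (R : realType) (d : nat) (alpha : 'rV[R]_d) (beta del : R) (N : nat) :
  0 < del <= 1 -> 2 ^+ d <= N%:R * del ^+ d ->
  exists (q : nat) (p : int), [/\ (0 < q <= N)%N, bohr alpha del q &
    `|q%:R * beta - p%:~R| < 2 ^+ d.+1 / (N%:R * del ^+ d)].
Proof.
move=> /andP[del0 del1] Ndel.
have dd0 : 0 < del ^+ d by rewrite exprn_gt0.
have Nd0 : 0 < N%:R * del ^+ d by apply: lt_le_trans Ndel; rewrite exprn_gt0.
have NR0 : 0 < N%:R :> R by move: Nd0; rewrite pmulr_lgt0.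
pose m := (Num.truncn del^-1).+1.
have mR0 : 0 < m%:R :> R by rewrite ltr0n.
have mgt : del^-1 < m%:R by exact: Num.Theory.truncnS_gt.
have mle : m%:R * del <= 2.
  rewrite /m -natr1 mulrDl mul1r.
  have : (Num.truncn del^-1)%:R * del <= 1.
    by rewrite -ler_pdivlMr // mul1r truncn_le invr_ge0 ltW.
  lra.
have mdN : (m ^ d <= N)%N.
  rewrite -(ler_nat R) natrX -(ler_pM2r dd0); apply: le_trans Ndel.
  by rewrite -exprMn lerXn2r ?nnegrE // mulr_ge0 // ltW.
pose M := (N %/ m ^ d)%N.
have md0 : (0 < m ^ d)%N by rewrite expn_gt0.
have M0 : (0 < M)%N by rewrite divn_gt0.
have MR0 : 0 < M%:R :> R by rewrite ltr0n.
have NM : N%:R <= 2 * (M%:R * m%:R ^+ d) :> R.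
  rewrite -natrX -!natrM ler_nat.
  have h1 := ltn_ceil N md0; rewrite -/M in h1.
  have h2 : (m ^ d <= M * m ^ d)%N by rewrite leq_pmull.
  by apply: leq_trans (ltnW h1) _; rewrite mulSn mul2n -addnn leq_add2r.
pose key (q : nat) : 'I_M := Ordinal (cell_lt (q%:R * beta) M0).
have [|q1 [q2 [/andP[q12 q2N] [keq] fl]]] :=
  @pigeonhole_fractional R 'I_d 'I_M (alpha 0) key m N isT.
  by rewrite !card_ord mulnC leq_divM.
exists (q2 - q1)%N, (Num.floor (q2%:R * beta) - Num.floor (q1%:R * beta)); split.
- by rewrite subn_gt0 q12 (leq_trans (leq_subr _ _)).
- apply/asboolP => i; exists (Num.floor (q2%:R * alpha 0 i) - Num.floor (q1%:R * alpha 0 i)).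
  apply: lt_trans (fl i) _.
  by rewrite -[ltRHS]invrK ltf_pV2 // posrE invr_gt0.
rewrite natrB ?(ltnW q12) // mulrBl; apply: lt_le_trans (cell_eq_dist M0 keq) _.
rewrite ler_pdivlMr // mulrC ler_pdivrMr // exprS.
apply: (@le_trans _ _ (2 * (M%:R * m%:R ^+ d) * del ^+ d)); first by rewrite ler_pM2r.
rewrite -!mulrA ler_pM2l // [leRHS]mulrC ler_pM2l //.
by rewrite -exprMn lerXn2r ?nnegrE // mulr_ge0 // ltW.
Qed.

(** * Measure of finite unions of balls *)

Definition balls (R : realType) (s : seq (R * R)) : set R :=
  \bigcup_(p in [set` s]) ball p.1 p.2.

Lemma balls_nil (R : realType) : balls [::] = set0 :> set R.
Proof. by apply/seteqP; split=> x // -[p]. Qed.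

Lemma balls_cat (R : realType) (s t : seq (R * R)) :
  balls (s ++ t) = balls s `|` balls t.
Proof.
apply/seteqP; split=> x [].
  move=> p; rewrite /= mem_cat => /orP[ps|pt] px; first by left; exists p.
  by right; exists p.
all: move=> [p pst px]; exists p => //=; rewrite mem_cat; apply/orP; by [left|right].
Qed.

Lemma balls_cons (R : realType) (p : R * R) (s : seq (R * R)) :
  balls (p :: s) = ball p.1 p.2 `|` balls s.
Proof.
rewrite -cat1s balls_cat; congr (_ `|` _); apply/seteqP; split=> x.
  by move=> [q]; rewrite /= inE => /eqP ->.
by exists p; rewrite //= inE.
Qed.

Lemma open_balls (R : realType) (s : seq (R * R)) : open (balls s).
Proof. by apply: bigcup_open => p _; exact: ball_open. Qed.

Lemma measurable_balls (R : realType) (s : seq (R * R)) : measurable (balls s).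
Proof. by apply: open_measurable; exact: open_balls. Qed.

Lemma lebesgue_measure_balls_le (R : realType) (s : seq (R * R)) :
  (forall p, p \in s -> 0 <= p.2) ->
  (lebesgue_measure (balls s) <= (\sum_(p <- s) 2 * p.2)%:E)%E.
Proof.
elim: s => [|p s IHs] s0; first by rewrite balls_nil measure0 big_nil.
have p0 : 0 <= p.2 by apply: s0; rewrite inE eqxx.
rewrite balls_cons big_cons EFinD; apply: le_trans (measureU2 _ _ _) _ => //.
- exact: measurable_ball.
- exact: measurable_balls.
apply: leeD; last by apply: IHs => q qs; apply: s0; rewrite inE qs orbT.
by rewrite /= lebesgue_measure_ball // mulr_natl.
Qed.

(** The price of fragmentation: enlarging a ball by [eta] adds 2 eta whatever its radius, so only
    the number of balls enters. *)
Lemma lebesgue_measure_inflate_le (R : realType) (s : seq (R * R)) (eta : R) :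
  0 <= eta -> (forall p, p \in s -> 0 <= p.2) ->
  (lebesgue_measure (balls [seq (p.1, (p.2 + eta)%R) | p <- s] `\` balls s)
    <= ((2 * eta) *+ size s)%:E)%E.
Proof.
move=> eta0; elim: s => [|p s IHs] s0; first by rewrite balls_nil set0D measure0.
have p0 : 0 <= p.2 by apply: s0; rewrite inE eqxx.
set t := [seq _ | _ <- s] in IHs.
have bsub : ball p.1 p.2 `<=` ball p.1 (p.2 + eta).
  by apply: le_ball; rewrite lerDl; exact: eta0.
have mb x r : measurable (ball x r : set R) by exact: measurable_ball.
have mt u := @measurable_balls R u.
apply: (@le_trans _ _ (lebesgue_measure
    ((ball p.1 (p.2 + eta) `\` ball p.1 p.2) `|` (balls t `\` balls s)))).
  apply: le_measure; rewrite ?inE.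
  - by apply: measurableD; exact: mt.
  - by apply: measurableU; apply: measurableD; solve [exact: mt|exact: mb].
  by rewrite /= !balls_cons => x [[xp|xt] /not_orP[nxp nxs]]; [left|right].
apply: le_trans (measureU2 _ _ _) _.
- by apply: measurableD; exact: mb.
- by apply: measurableD; exact: mt.
rewrite mulrS EFinD; apply: leeD; last by apply: IHs => q qs; apply: s0; rewrite inE qs orbT.
rewrite measureD; [|exact: mb|exact: mb|by rewrite /= lebesgue_measure_ball ?addr_ge0 // ltry].
rewrite setIidr //= !lebesgue_measure_ball ?addr_ge0 // -EFinB lee_fin.
by rewrite le_eqVlt; apply/orP; left; apply/eqP; ring.
Qed.

Lemma lebesgue_measure_balls_separated (R : realType) (D : seq R) (r s : R) :
  0 <= s <= r -> pairwise (fun x y => 2 * r <= `|x - y|) D ->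
  lebesgue_measure (balls [seq (x, s) | x <- D]) = ((2 * s) *+ size D)%:E.
Proof.
move=> /andP[s0 sr]; elim: D => [|x D IHD]; first by rewrite balls_nil measure0.
rewrite /= => /andP[/allP xD /IHD IH].
rewrite balls_cons measureU //=; last 3 first.
- exact: measurable_ball.
- exact: measurable_balls.
- apply/seteqP; split=> // y [xy [_ /mapP[z zD ->]] /= zy].
  have := xD z zD; rewrite leNgt => /negP; apply.
  have -> : x - z = (x - y) - (z - y) by ring.
  apply: le_lt_trans (ler_normB _ _) _.
  move: xy zy; rewrite /ball /= => xy zy; lra.
by rewrite IH lebesgue_measure_ball // -EFinD mulr_natl [in RHS]mulrS.
Qed.

(** Greedy choice: a point is kept unless one already chosen is closer than [r]. *)
Lemma separated_subseq (R : realType) (G : seq R) (r : R) : 0 < r ->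
  exists D : seq R, [/\ {subset D <= G}, pairwise (fun x y => r <= `|x - y|) D &
    forall x, x \in G -> exists2 y, y \in D & `|x - y| < r].
Proof.
move=> r0; elim: G => [|x G [D [DG Dsep Dnear]]]; first by exists [::].
have [[y yD xy]|/forall2NP far] := pselect (exists2 y, y \in D & `|x - y| < r).
  exists D; split=> // [z /DG zG|z]; first by rewrite inE zG orbT.
  by rewrite inE => /orP[/eqP ->|/Dnear //]; exists y.
exists (x :: D); split.
- by move=> z; rewrite !inE => /orP[->//|/DG ->]; rewrite orbT.
- rewrite /= Dsep andbT; apply/allP => y yD; rewrite leNgt; apply/negP => xy.
  by have [/(_ yD)|/(_ xy)] := far y.
move=> z; rewrite inE => /orP[/eqP ->|/Dnear[y yD zy]].
  by exists x; rewrite ?inE ?eqxx // subrr normr0.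
by exists y; rewrite // inE yD orbT.
Qed.

(* Points of the interval outside [W], [Bad] and the [(r + s)]-neighbourhood of
   [U] have measure at least [f / 2], and each has within [r] a center whose
   [s]-ball misses [U]; a separated choice of these centers gives the gain. *)
Lemma ubiquity_step (R : realType) (a f r s : R) (U Bad : seq (R * R)) (G : seq R)
    (W : set R) :
  measurable W -> (f%:E <= lebesgue_measure (`[a, (a + 1)%R[ `\` W))%E ->
  balls U `<=` W ->
  (forall p, p \in U -> 0 <= p.2) -> (forall p, p \in Bad -> 0 <= p.2) ->
  (forall beta, a <= beta < a + 1 ->
     balls Bad beta \/ exists2 x, x \in G & `|beta - x| < r) ->
  0 < s <= r -> \sum_(p <- Bad) 2 * p.2 <= f / 4 ->
  (2 * (r + s)) *+ size U <= f / 4 ->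
  (lebesgue_measure (balls U) + (f * (s / r) / 6)%R%:E
    <= lebesgue_measure (balls (U ++ [seq (x, s) | x <- G])))%E.
Proof.
move=> mW fW UW U0 Bad0 cov /andP[s0 sr] Badf Uf.
have r0 : 0 < r by exact: lt_le_trans sr.
pose Ui := [seq (p.1, p.2 + (r + s)) | p <- U].
pose F := `[a, a + 1[ `\` (balls Bad `|` balls Ui).
have mb u := @measurable_balls R u.
have mF : measurable F by apply: measurableD => //; apply: measurableU.
have Ff : ((f / 2)%:E <= lebesgue_measure F)%E.
  have cover : `[a, a + 1[ `\` W `<=` F `|` (balls Bad `|` (balls Ui `\` balls U)).
    move=> x [xI xW]; have [xBad|xBad] := pselect (balls Bad x); first by right; left.
    have [xUi|xUi] := pselect (balls Ui x).
      by right; right; split=> // xU; apply: xW; exact: UW.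
    by left; split=> // -[].
  have mUU : measurable (balls Ui `\` balls U) by apply: measurableD; exact: mb.
  have mBU : measurable (balls Bad `|` (balls Ui `\` balls U)).
    by apply: measurableU; [exact: mb|exact: mUU].
  (* The bad balls and the collar around [U] cost f/4 each, which leaves f/2 for [F]. *)
  have le1 : (f%:E <= lebesgue_measure F + (f / 4 + f / 4)%:E)%E.
    apply: le_trans fW _; 
    apply: (@le_trans _ _ (lebesgue_measure (F `|` (balls Bad `|` (balls Ui `\` balls U))))).
      apply: le_measure; rewrite ?inE; last exact: cover.
        exact: measurableD.
      by apply: measurableU; [exact: mF|exact: mBU].
    apply: le_trans (measureU2 _ _ _) _; [exact: mF|exact: mBU|].
    apply: leeD; first exact: lexx.
    apply: le_trans (measureU2 _ _ _) _; [exact: mb|exact: mUU|].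
    rewrite EFinD; apply: leeD.
      by apply: le_trans (lebesgue_measure_balls_le Bad0) _; rewrite lee_fin.
    apply: le_trans (lebesgue_measure_inflate_le _ U0) _; last by rewrite lee_fin.
    by rewrite addr_ge0 // ltW.
  have -> : f / 2 = f - (f / 4 + f / 4) by field.
  by rewrite EFinB leeBlDr.
pose G' := [seq x <- G | `[< exists2 b, F b & `|b - x| < r >]].
have r20 : 0 < 2 * r by rewrite mulr_gt0.
have [D [DG Dsep Dnear]] := @separated_subseq R G' (2 * r) r20.
(* The radius 3r is r, from a point of [F] to a center, plus 2r, from that center to a chosen
   one. *)
have FD : (lebesgue_measure F <= ((2 * (3 * r)) *+ size D)%:E)%E.
  have sub : F `<=` balls [seq (x, 3 * r) | x <- D].
    move=> b Fb; have [bI /not_orP[nBad nUi]] := Fb.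
    have [//|[x xG bx]] : balls Bad b \/ exists2 x, x \in G & `|b - x| < r.
      by apply: cov; move: bI; rewrite /= in_itv.
    have xG' : x \in G' by rewrite mem_filter xG andbT; apply/asboolP; exists b.
    have [y yD xy] := Dnear x xG'.
    exists (y, 3 * r); first by apply/mapP; exists y.
    rewrite /= /ball /= distrC; have -> : b - y = (b - x) + (x - y) by ring.
    by apply: le_lt_trans (ler_normD _ _) _; lra.
  apply: (@le_trans _ _ (lebesgue_measure (balls [seq (x, 3 * r) | x <- D]))).
    by apply: le_measure; rewrite ?inE; [exact: mF|exact: mb|exact: sub].
  apply: le_trans (lebesgue_measure_balls_le _) _.
    by move=> p /mapP[x _ ->] /=; rewrite mulr_ge0 // ltW.
  rewrite big_map /= big_const_seq count_predT iter_addr_0 lee_fin //.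
have Dsize : f * (s / r) / 6 <= (2 * s) *+ size D.
  rewrite -[leRHS]mulr_natr.
  have := le_trans Ff FD; rewrite lee_fin -[in X in _ <= X]mulr_natr => h.
  have -> : f * (s / r) / 6 = (f / 2) * (s / (3 * r)) by field; exact: lt0r_neq0.
  have -> : 2 * s * (size D)%:R = 2 * (3 * r) * (size D)%:R * (s / (3 * r)).
    by field; exact: lt0r_neq0.
  by rewrite ler_wpM2r // divr_ge0 ?mulr_ge0 // ltW.
rewrite balls_cat.
apply: (@le_trans _ _ (lebesgue_measure (balls U `|` balls [seq (x, s) | x <- D]))).
  rewrite measureU; [|exact: mb|exact: mb|]; last first.
    apply/seteqP; split=> // y [[p pU py] [_ /mapP[x xD ->] /= xy]].
    have := DG x xD; rewrite mem_filter => /andP[/asboolP[b [_ /not_orP[_ nUi]] bx] _].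
    apply: nUi; exists (p.1, p.2 + (r + s)); first by apply/mapP; exists p.
    move: py xy; rewrite /ball /= => py xy.
    have -> : p.1 - b = (p.1 - y) + (- (b - x) - (x - y)) by ring.
    apply: le_lt_trans (ler_normD _ _) _; apply: ltrD => //.
    apply: le_lt_trans (ler_normB _ _) _; rewrite normrN; exact: ltrD.
  apply: leeD; first exact: lexx.
  rewrite /= (@lebesgue_measure_balls_separated _ _ r) ?lee_fin //.
  by rewrite (ltW s0).
apply: le_measure; rewrite ?inE; [apply: measurableU; exact: mb|apply: measurableU; exact: mb|].
move=> y [yU|[p /mapP[x xD ->] xy]]; [by left|right].
exists (x, s) => //; apply/mapP; exists x => //.
by have := DG x xD; rewrite mem_filter => /andP[].
Qed.

(** Iterating [ubiquity_step] over the good scales gains f/6 times s/r at each of them, while all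
    the balls stay in an interval of length 3. The bound on the sums of [X] keeps the fragmentation
    by earlier scales within f/4. *)
Lemma ubiquity_sum_bounded (R : realType) (a f : R) (W : set R) (good : pred nat)
    (G : nat -> seq R) (Bad : nat -> seq (R * R)) (r s X : nat -> R) :
  0 < f -> measurable W -> (f%:E <= lebesgue_measure (`[a, (a + 1)%R[ `\` W))%E ->
  (forall l, good l -> 0 < s l <= r l /\ s l <= 1) ->
  (forall l, good l -> (forall p, p \in Bad l -> 0 <= p.2) /\
     \sum_(p <- Bad l) 2 * p.2 <= f / 4) ->
  (forall l, good l -> forall beta, a <= beta < a + 1 ->
     balls (Bad l) beta \/ exists2 x, x \in G l & `|beta - x| < r l) ->
  (forall l, good l -> balls [seq (x, s l) | x <- G l] `<=` W) ->
  (forall l, good l -> {in G l, forall x, a <= x <= a + 1}) ->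
  (forall l, good l -> (size (G l))%:R <= X l) ->
  (forall l, good l -> 16 * r l * \sum_(k < l | good k) X k <= f) ->
  forall m, \sum_(l < m | good l) s l / r l <= 18 / f.
Proof.
move=> f0 mW fW rs BadP cov GW Ga GX Xf m.
pose E l := if good l then [seq (x, s l) | x <- G l] else [::].
pose U m := flatten [seq E l | l <- iota 0 m].
have US l : U l.+1 = U l ++ E l.
  by rewrite /U -[l.+1]addn1 iotaD map_cat flatten_cat /= cats0.
have memE p l : p \in E l -> good l /\ exists2 x, x \in G l & p = (x, s l).
  by rewrite /E; case: ifP => // gl /mapP[x xG ->]; split=> //; exists x.
have inU p l : p \in U l -> exists k, p \in E k.
  by move=> /flatten_mapP[k _ pk]; exists k.
have UW l : balls (U l) `<=` W.
  move=> y [p /inU[k /[dup] pk /memE[gk _]] py]; apply: (GW k gk).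
  by exists p => //; move: pk; rewrite /E gk.
have U0 l p : p \in U l -> 0 <= p.2.
  by move=> /inU[k /memE[gk [x _ ->]]]; have [/andP[/ltW]] := rs k gk.
(* Centers lie in [a, a + 1] and radii are at most 1, so everything lies in the interval from a - 1
   to a + 2. *)
have Usub l : balls (U l) `<=` ball (a + 2^-1) (3 / 2).
  move=> y [p /inU[k /memE[gk [x xG ->]]] /= xy].
  have /andP[ax xa] := Ga k gk x xG; have [_ s1] := rs k gk.
  move: xy; rewrite /ball /= !ltr_norml => /andP[xy1 xy2].
  by apply/andP; split; lra.
have Usize l : (size (U l))%:R <= \sum_(k < l | good k) X k.
  elim: l => [|l IHl]; first by rewrite big_ord0.
  rewrite US size_cat natrD big_mkcond big_ord_recr -big_mkcond /= lerD //.
  by rewrite /E; case: ifP => // gl; rewrite size_map; exact: GX.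
have step l : ((f / 6 * \sum_(k < l | good k) s k / r k)%:E <= lebesgue_measure (balls (U l)))%E.
  elim: l => [|l IHl]; first by rewrite big_ord0 mulr0 measure_ge0.
  rewrite US big_mkcond big_ord_recr -big_mkcond /= /E; case: ifPn => gl; last first.
    by rewrite addr0 cats0.
  have [slr s1] := rs l gl; have [Bad0 Badf] := BadP l gl.
  have sl0 : 0 < s l by case/andP: slr.
  have sr : s l <= r l by case/andP: slr.
  have Usmall : (2 * (r l + s l)) *+ size (U l) <= f / 4.
    rewrite -[leLHS]mulr_natr.
    apply: (@le_trans _ _ (4 * r l * \sum_(k < l | good k) X k)).
      by apply: ler_pM => //; [rewrite mulr_ge0 // addr_ge0 // ltW // (lt_le_trans sl0)|lra].
    by have := Xf l gl; lra.
  have := ubiquity_step mW fW (UW l) (@U0 l) Bad0 (cov l gl) slr Badf Usmall.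
  apply: le_trans; rewrite mulrDr EFinD; apply: leeD => //.
  by rewrite lee_fin le_eqVlt; apply/orP; left; apply/eqP; ring.
have : (lebesgue_measure (balls (U m)) <= 3%:E)%E.
  apply: (@le_trans _ _ (lebesgue_measure (ball (a + 2^-1) (3 / 2) : set R))).
    by apply: le_measure; rewrite ?inE; [exact: measurable_balls|exact: measurable_ball|].
  by rewrite lebesgue_measure_ball // lee_fin; lra.
move=> /(le_trans (step m)); rewrite lee_fin ler_pdivlMr // => h; lra.
Qed.

(** * Coverings by rationals with good denominators *)

Definition rationals_in (R : realType) (a : R) (s : seq nat) : seq R :=
  [seq a + p%:R / q%:R | q <- s, p <- iota 0 q.+1].

Lemma rationals_in_itv (R : realType) (a : R) (s : seq nat) :
  {in s, forall q, (0 < q)%N} -> {in rationals_in a s, forall x, a <= x <= a + 1}.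
Proof.
move=> s0 x /allpairsPdep[q [p [qs]]]; rewrite mem_iota add0n ltnS => /= pq ->.
have q0 : 0 < q%:R :> R by rewrite ltr0n s0.
by rewrite lerDl divr_ge0 ?lerD2l //= ler_pdivrMr // mul1r ler_nat.
Qed.

Lemma size_rationals_in (R : realType) (a : R) (s : seq nat) (N : nat) :
  {in s, forall q, (0 < q <= N)%N} -> (size (rationals_in a s) <= 2 * N * size s)%N.
Proof.
rewrite size_allpairs_dep; elim: s => [|q s IHs] sN; first by rewrite muln0.
rewrite /= size_iota mulnS leq_add //; last by apply: IHs => z zs; apply: sN; rewrite inE zs orbT.
by have /andP[q0 qN] := sN q (mem_head _ _); lia.
Qed.

(** Dirichlet's theorem for [beta - a], split by the size of the denominator: beyond [M] the radius
    T/q is at most the common value T/M, and the remaining balls form the first alternative. *)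
Lemma scale_coverage (R : realType) (d : nat) (alpha : 'rV[R]_d) (a del : R) (N M : nat) :
  0 < del <= 1 -> 2 ^+ d.+1 <= N%:R * del ^+ d -> (0 < M)%N ->
  let T := 2 ^+ d.+1 / (N%:R * del ^+ d) in
  forall beta, a <= beta < a + 1 ->
  balls [seq (a + p%:R / q%:R, T / q%:R) | q <- [seq q <- iota 1 M | bohr alpha del q],
     p <- iota 0 q.+1] beta \/
  exists2 x, x \in rationals_in a [seq q <- iota 1 N | bohr alpha del q && (M < q)%N] &
    `|beta - x| < T / M%:R.
Proof.
move=> del01 Ndel M0 T beta /andP[ab ba].
have Ndel' : 2 ^+ d <= N%:R * del ^+ d.
  by apply: le_trans Ndel; rewrite exprS ler_peMl // ?exprn_ge0 // ler1n.
have Nd0 : 0 < N%:R * del ^+ d by apply: lt_le_trans Ndel; rewrite exprn_gt0.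
have T0 : 0 < T by rewrite divr_gt0 // exprn_gt0.
(* With [T] at most 1, the numerator is confined to 0 <= p <= q. *)
have T1 : T <= 1 by rewrite ler_pdivrMr // mul1r.
have [q [p [/andP[q0 qN] qb qp]]] := @dirichlet_line R d alpha (beta - a) del N del01 Ndel'.
rewrite -/T in qp.
have qR0 : 0 < q%:R :> R by rewrite ltr0n.
have b0 : 0 <= q%:R * (beta - a) by rewrite mulr_ge0 ?subr_ge0 // ler0n.
have b1 : q%:R * (beta - a) < q%:R by rewrite gtr_pMr // ltrBlDl.
move: qp; rewrite ltr_norml => /andP[qp1 qp2].
have p0 : 0 <= p.
  have : (- 1)%:~R < p%:~R :> R by rewrite intrN; lra.
  by rewrite ltr_int -lezD1 addNr.
case: p p0 qp1 qp2 => // p _ qp1 qp2.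
have pq : (p <= q)%N.
  have : p%:R < q.+1%:R :> R by rewrite -natr1; move: qp1; rewrite -pmulrn; lra.
  by rewrite ltr_nat ltnS.
have dist : `|beta - (a + p%:R / q%:R)| < T / q%:R.
  rewrite ltr_pdivlMr // -[X in _ * X](gtr0_norm qR0) -normrM.
  have -> : (beta - (a + p%:R / q%:R)) * q%:R = q%:R * (beta - a) - p%:R.
    by field; exact: lt0r_neq0.
  by rewrite ltr_norml qp1 qp2.
have pi : p \in iota 0 q.+1 by rewrite mem_iota add0n ltnS.
have [qM|Mq] := leqP q M; [left|right].
  exists (a + p%:R / q%:R, T / q%:R); last by rewrite /= /ball /= distrC.
  apply/allpairsPdep; exists q, p; split=> //.
  by rewrite mem_filter qb mem_iota q0 add1n ltnS.
exists (a + p%:R / q%:R).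
  by apply/allpairsPdep; exists q, p; split=> //; rewrite mem_filter qb Mq mem_iota q0 add1n ltnS.
apply: lt_le_trans dist _; rewrite ler_pM2l // lef_pV2 ?posrE ?ltr0n //.
by rewrite ler_nat ltnW.
Qed.

(** A denominator q carries q + 1 <= 2q balls of length 2T/q. *)
Lemma sum_low_radii (R : realType) (a T : R) (s : seq nat) : 0 <= T ->
  {in s, forall q, (0 < q)%N} ->
  \sum_(p <- [seq (a + p%:R / q%:R, T / q%:R) | q <- s, p <- iota 0 q.+1]) 2 * p.2
    <= 4 * T * (size s)%:R.
Proof.
move=> T0 s0; rewrite big_allpairs_dep /=.
have -> : 4 * T * (size s)%:R = \sum_(q <- s) 4 * T.
  by rewrite big_const_seq count_predT iter_addr_0 [LHS]mulr_natr.
rewrite big_seq [leRHS]big_seq; apply: ler_sum => q /s0 q0.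
have qR1 : 1 <= q%:R :> R by rewrite ler1n.
have qR0 : 0 < q%:R :> R by rewrite ltr0n.
rewrite big_const_seq count_predT /= size_iota iter_addr_0 -[X in _ + X <= _]mulr_natr.
have -> : 2 * (T / q%:R) + 2 * (T / q%:R) * q%:R = 2 * T * ((q%:R + 1) / q%:R) by field; exact: lt0r_neq0.
have : (q%:R + 1) / q%:R <= 2 :> R by rewrite ler_pdivrMr //; lra.
have T20 : 0 <= 2 * T by rewrite mulr_ge0.
by move=> /(ler_wpM2l T20); lra.
Qed.

(** The [beta] for which some denominator q >= Q is good. This set is open, and the intersection
    over [Q] is the limsup set sought. *)
Definition approx_tail (R : realType) (d : nat) (alpha : 'rV[R]_d) (psi : R -> R)
    (Q : nat) : set R :=
  \bigcup_(q in [set q | [/\ (Q <= q)%N, (0 < q)%N & bohr alpha (psi q%:R) q]])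
    \bigcup_(z in [set: int]) ball (z%:~R / q%:R : R) (psi q%:R / q%:R).

Lemma measurable_approx_tail (R : realType) (d : nat) (alpha : 'rV[R]_d) (psi : R -> R)
    (Q : nat) : measurable (approx_tail alpha psi Q).
Proof.
apply: open_measurable; apply: bigcup_open => q _; apply: bigcup_open => z _.
exact: ball_open.
Qed.

(** Monotonicity of [psi] gives del <= psi(N) <= psi(q) for q <= N. As [a] is an integer, a + p/q is
    again a fraction with denominator q. *)
Lemma balls_sub_approx_tail (R : realType) (d : nat) (alpha : 'rV[R]_d) (psi : R -> R)
    (Q N M : nat) (a : int) (del : R) :
  approximating_function psi -> (Q <= M)%N -> 0 < del <= psi N%:R ->
  balls [seq (x, del / N%:R) | x <- rationals_in a%:~R
    [seq q <- iota 1 N | bohr alpha del q && (M < q)%N]] `<=` approx_tail alpha psi Q.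
Proof.
move=> [psi0 psid] QM /andP[del0 delpsi] y [_ /mapP[x /allpairsPdep[q [p []]] +++ ->]].
rewrite mem_filter mem_iota add1n ltnS => /andP[/andP[qb Mq] /andP[q0 qN]] _ -> /= xy.
have qR0 : 0 < q%:R :> R by rewrite ltr0n.
have N0 : 0 < N%:R :> R by rewrite ltr0n (leq_trans q0).
have dq : del <= psi q%:R by apply: le_trans delpsi _; apply: psid; rewrite ?ler_nat.
exists q; first split=> //.
- by rewrite (leq_trans QM) // ltnW.
- apply/asboolP => i; move/asboolP : qb => /(_ i)[z zlt]; exists z.
  exact: lt_le_trans zlt dq.
exists (a * q%:Z + p%:Z) => //; rewrite /ball /=.
have -> : (a * q%:Z + p%:Z)%:~R / q%:R = a%:~R + p%:R / q%:R :> R.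
  by rewrite intrD intrM -!pmulrn mulrDl mulfK // lt0r_neq0.
apply: lt_le_trans xy _; apply: ler_pM => //; [exact: ltW|by rewrite lef_pV2 ?posrE ?ler_nat].
Qed.

(** * Full measure of the tail sets *)

Lemma ltr_powR_exponent (R : realType) (x s t : R) : 1 < x -> s < t -> x `^ s < x `^ t.
Proof.
move=> x1 st; have x0 : 0 < x by apply: lt_trans x1.
rewrite -[t](subrK s) powRD ?(gt_eqF x0) ?implybT // ltr_pMl ?powR_gt0 //.
have <- : 1 `^ (t - s) = 1 :> R by rewrite powR1.
by rewrite gt0_ltr_powR ?subr_gt0 ?nnegrE // ltW.
Qed.

Lemma exprn_eventually_le (R : realType) (x eps : R) : 0 <= x < 1 -> 0 < eps ->
  exists k0 : nat, forall l, (k0 <= l)%N -> x ^+ l <= eps.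
Proof.
move=> /andP[x0 x1] eps0.
have /cvgrPdist_le/(_ _ eps0)[k0 _ k0P] : GRing.exp x @ \oo --> (0 : R).
  by apply: cvg_expr; rewrite ger0_norm.
exists k0 => l /k0P /=; rewrite sub0r normrN ger0_norm ?exprn_ge0 //.
Qed.

Lemma powR_exprn (R : realType) (x t : R) (l : nat) : 0 <= x ->
  (x ^+ l) `^ t = (x `^ t) ^+ l.
Proof.
by move=> x0; rewrite -powR_mulrn // -powRrM mulrC powRrM powR_mulrn ?powR_ge0.
Qed.

Lemma sum_geometric_tail_le (R : realType) (x : R) (l : nat) : 0 <= x <= 2^-1 ->
  \sum_(k < l) x ^+ (l - k) <= 2 * x.
Proof.
move=> /andP[x0 x1]; elim: l => [|l IHl]; first by rewrite big_ord0 mulr_ge0.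
rewrite big_ord_recr /= subSnn expr1.
have -> : \sum_(k < l) x ^+ (l.+1 - k) = x * \sum_(k < l) x ^+ (l - k).
  by rewrite mulr_sumr; apply: eq_bigr => k _; rewrite subSn ?exprS // ltnW.
have := ler_wpM2l x0 IHl; have := ler_wpM2l x0 x1; lra.
Qed.

Lemma sum_kept_le_tail (R : realType) (P : pred nat) (u : nat -> R) (k0 m : nat) :
  (forall k, 0 <= u k <= 1) ->
  \sum_(l < m | P l) u l <= k0%:R + \sum_(l < m | (k0 <= l)%N && P l) u l.
Proof.
move=> u01.
suff : \sum_(l < m | P l) u l <= (minn m k0)%:R + \sum_(l < m | (k0 <= l)%N && P l) u l.
  by move/le_trans; apply; rewrite lerD2r ler_nat geq_minr.
elim: m => [|m IHm]; first by rewrite !big_ord0 min0n addr0.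
rewrite big_mkcond big_ord_recr -big_mkcond /=.
rewrite [in leRHS]big_mkcond [in leRHS]big_ord_recr -big_mkcond /=.
have /andP[um0 um1] := u01 m.
have [k0m|mk0] := leqP k0 m.
  rewrite (minn_idPr (leqW k0m)) addrA; apply: lerD => //.
  by rewrite (minn_idPr k0m) in IHm.
rewrite (minn_idPl (ltnW mk0)) in IHm; rewrite (minn_idPl mk0) /= addr0 -natr1.
rewrite addrAC; apply: lerD => //; by case: ifP.
Qed.

(* Scale [l] has [N = b^(n l)] and [del = min(psi N, b^-l)], so that
   [N del^n = e^n].  Taking [b] of the order of [1 / f] makes both the
   low denominators [q <= N / b^n] and the fragmentation by earlier scales cost
   at most [f / 4]; [nu] is close enough to [1] that the counting bound applies
   at all large kept scales. *)
Lemma approx_tail_full (R : realType) (d : nat) (alpha : 'rV[R]_d) (psi : R -> R)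
    (tau c : R) (a : int) (Q : nat) :
  (0 < d)%N -> 0 < tau -> tau < d.+1%:R -> 0 < c ->
  (forall (h : 'rV[int]_d) (z : int), h != 0 ->
      c * `|map_mx intr h : 'rV[R]_d| `^ (- tau)
        <= `|\sum_j (h 0 j)%:~R * alpha 0 j - z%:~R|) ->
  approximating_function psi ->
  (\sum_(1 <= q <oo) (psi q%:R ^+ d.+1)%:E)%E = +oo%E ->
  lebesgue_measure (`[a%:~R, (a%:~R + 1)%R[ `\` approx_tail alpha psi Q) = 0%E.
Proof.
move=> d0 tau0 taun c0 sep psiA psioo; set n := d.+1; set W := approx_tail _ _ _.
have [psi0 psid] := psiA.
have mW : measurable W by exact: measurable_approx_tail.
pose A : R := a%:~R.
have mIW : measurable (`[A, A + 1[ `\` W) by exact: measurableD.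
(* Suppose that the tail misses a subset of positive measure, called [f] below. *)
apply/eqP; rewrite eq_le measure_ge0 andbT leNgt; apply/negP => fpos.
have ffin : (lebesgue_measure (`[A, (A + 1)%R[ `\` W) <= 1%:E)%E.
  apply: (@le_trans _ _ (lebesgue_measure (`[A, (A + 1)%R[ : set R))).
    by apply: le_measure; rewrite ?inE //; exact: subDsetl.
  by rewrite lebesgue_measure_itv /= lte_fin ltrDl ltr01 -EFinB lee_fin addrC addKr.
set f := fine (lebesgue_measure (`[A, (A + 1)%R[ `\` W)).
have fE : lebesgue_measure (`[A, (A + 1)%R[ `\` W) = f%:E.
  rewrite /f fineK // fin_numE; apply/andP; split; apply/eqP => E.
    by move: fpos; rewrite E.
  by move: ffin; rewrite E.
have f0 : 0 < f by rewrite -lte_fin -fE.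
pose C0 : R := 32 * (32 * d%:R) ^+ d.
have dR0 : 0 < d%:R :> R by rewrite ltr0n.
have C00 : 0 < C0 by rewrite mulr_gt0 // exprn_gt0 // mulr_gt0.
(* The first summand makes the ratio in [x01] at most 1/2; the second gives [bC], which bounds both
   the low denominators and the fragmentation. *)
pose b := (2 ^ n + Num.bound (2 ^+ (d + d + 7) * C0 / f))%N.
have b2n : 2 ^+ n <= b%:R :> R by rewrite -natrX ler_nat leq_addr.
have bC : 2 ^+ (d + d + 7) * C0 / b%:R <= f.
  have h : 2 ^+ (d + d + 7) * C0 / f <= b%:R.
    apply: (@le_trans _ _ (Num.bound (2 ^+ (d + d + 7) * C0 / f))%:R).
      by apply/ltW/archi_boundP; rewrite divr_ge0 ?(ltW f0) // mulr_ge0 ?(ltW C00) // exprn_ge0.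
    by rewrite ler_nat leq_addl.
  have bR0 : 0 < b%:R :> R by apply: lt_le_trans b2n; rewrite exprn_gt0.
  by rewrite ler_pdivrMr // [leRHS]mulrC -ler_pdivrMr.
have b2 : (2 <= b)%N.
  by rewrite -(ler_nat R); apply: le_trans b2n; rewrite exprS ler_peMr // exprn_ege1 // ler1n.
have bR2 : 2 <= b%:R :> R by rewrite (ler_nat _ 2).
have p7 : 2 ^+ (d + d + 7) = 2 ^+ d * 2 ^+ d * 128 :> R.
  by rewrite !exprD; congr (_ * _); rewrite -natrX.
clearbody b; set bR : R := b%:R in b2n bC bR2.
have bR1 : 1 < bR by lra.
have bR0 : 0 < bR by lra.
(* Chosen so that [(1 + eps) * tau] is the midpoint of [tau] and [n], whence [thBr]. *)
pose eps := (n%:R / tau - 1) / 2.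
have eps0 : 0 < eps by rewrite divr_gt0 // subr_gt0 ltr_pdivlMr // mul1r.
(* The bound 1/2 serves [F4] and [Xratio]; the bound b^(-eps) serves [F3] through [nub]. *)
pose nu := Num.max (2^-1) (bR `^ (- eps)).
have nu2 : 2^-1 <= nu by rewrite le_max lexx.
have nu0 : 0 < nu by apply: lt_le_trans nu2.
have nu1 : nu < 1.
  rewrite gt_max invf_lt1 // ltr1n /= -(powRr0 bR).
  by apply: ltr_powR_exponent => //; rewrite oppr_lt0.
have nub : bR / nu <= bR `^ (1 + eps).
  rewrite ler_pdivrMr // powRD ?(gt_eqF bR0) ?implybT // powRr1 ?(ltW bR0) // -mulrA.
  rewrite ler_peMr ?(ltW bR0) //.
  apply: le_trans (_ : bR `^ eps * bR `^ (- eps) <= _).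
    by rewrite powRN divff // gt_eqF // powR_gt0.
  by rewrite ler_pM2l ?powR_gt0 // le_max lexx orbT.
pose Br := bR ^+ n.
have Br0 : 0 < Br by rewrite exprn_gt0.
have BrbR : bR <= Br by rewrite /Br exprS ler_peMr ?(ltW bR0) // exprn_ege1 // ltW.
pose th := bR `^ ((1 + eps) * tau).
have thBr : th < Br.
  rewrite /th /Br -powR_mulrn ?(ltW bR0) //; apply: ltr_powR_exponent => //.
  have -> : (1 + eps) * tau = (tau + n%:R) / 2 by rewrite /eps; field; exact: lt0r_neq0.
  by rewrite -/n in taun; lra.
have th0 : 0 < th by rewrite powR_gt0.
pose N l := ((b ^ n) ^ l)%N.
have NR l : (N l)%:R = Br ^+ l :> R by rewrite /N /Br !natrX.
pose e l := Num.min 1 (bR ^+ l * psi (N l)%:R).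
have N0 l : (0 < N l)%N by rewrite /N !expn_gt0 (ltnW b2).
have NR0 l : 0 < (N l)%:R :> R by rewrite ltr0n.
pose y l := bR ^+ l.
have y0 l : 0 < y l by rewrite exprn_gt0.
have e0 l : 0 < e l by rewrite lt_min ltr01 mulr_gt0 ?psi0.
have e1 l : e l <= 1 by rewrite ge_min lexx.
have Ny l : (N l)%:R = y l ^+ n by rewrite NR /Br /y -!exprM mulnC.
pose del l := e l / y l.
have del0 l : 0 < del l by rewrite divr_gt0.
have delpsi l : del l <= psi (N l)%:R.
  by rewrite ler_pdivrMr // mulrC ge_min lexx orbT.
have dely l : del l * y l = e l by rewrite mulfVK // lt0r_neq0.
have Ndel l : (N l)%:R * del l ^+ d = y l * e l ^+ d.
  by rewrite Ny exprS -mulrA -exprMn [y l * del l]mulrC dely.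
have Ndeln l : (N l)%:R * del l ^+ n = e l ^+ n.
  by rewrite Ny -exprMn mulrC dely.
have y1 l : 1 <= y l by rewrite exprn_ege1 // ltW.
have del1 l : del l <= 1 by rewrite ler_pdivrMr // mul1r (le_trans (e1 l)).
pose X l := (N l)%:R ^+ 2 * del l ^+ d.
have X0 l : 0 < X l by rewrite mulr_gt0 ?exprn_gt0.
pose K := kept e nu.
have Kdecay k l : (k <= l)%N -> K l -> nu ^+ (l - k) * e k <= e l.
  by move=> kl Kl; apply: kept_decay => //; exact: ltW.
(* The thresholds [k1], [k2], [k3] yield [F2], [F3], [F4] respectively; [Q] enters [k0] so that all
   denominators used are at least [Q]. *)
have [k1 k1P] : exists k1, forall l, (k1 <= l)%N -> 2^-1 ^+ l <= (16 * d%:R)^-1 :> R.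
  by apply: exprn_eventually_le; rewrite ?invr_gt0 ?mulr_gt0 //; lra.
have [k2 k2P] : exists k2, forall l, (k2 <= l)%N ->
    (th / Br) ^+ l <= 16 * c / (Br * (e 0%N)^-1 `^ tau).
  apply: exprn_eventually_le.
    by rewrite divr_ge0 ?(ltW th0) ?(ltW Br0) //= ltr_pdivrMr // mul1r.
  by rewrite divr_gt0 ?mulr_gt0 // powR_gt0 // invr_gt0.
have [k3 k3P] : exists k3, forall l, (k3 <= l)%N -> 2^-1 ^+ l <= e 0%N ^+ d / 2 ^+ n.
  by apply: exprn_eventually_le; [lra|rewrite divr_gt0 ?exprn_gt0].
pose k0 := (k1 + k2 + k3 + Q).+1.
pose good l := (k0 <= l)%N && K l.
have goodK l : good l -> K l by case/andP.
have goodk l : good l -> [/\ (k1 <= l)%N, (k2 <= l)%N, (k3 <= l)%N & (Q < l)%N].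
  by case/andP => + _; rewrite /k0; clear => kl; split; lia.
(* The cutoff is the previous scale, N / b^n; good indices are positive, so [l.-1] is a true
   predecessor there. *)
pose M l := N l.-1.
have NM l : good l -> (N l)%:R = Br * (M l)%:R.
  by move=> /goodk[_ _ _]; case: l => // l _; rewrite /M /= !NR exprS.
have M0 l : (0 < M l)%N by exact: N0.
have MR0 l : 0 < (M l)%:R :> R by rewrite ltr0n.
have QM l : good l -> (Q <= M l)%N.
  move=> /goodk[_ _ _]; case: l => // l; rewrite ltnS /M /= => Ql.
  apply: leq_trans Ql _; apply: ltnW; apply: ltn_expl.
  by rewrite (leq_trans b2) // -[leqLHS]expn1 leq_exp2l.
(* Comparison of a kept scale with scale 0 gives the exponential lower bound on [e] behind [F3] and
   [F4]. *)
have ege l : good l -> nu ^+ l * e 0%N <= e l.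
  by move=> gl; have := Kdecay 0%N l (leq0n _) (goodK l gl); rewrite subn0.
have F2 l : good l -> 16 * d%:R * del l <= 1.
  move=> /goodk[kl _ _ _]; rewrite -[leRHS](@divff _ (16 * d%:R)) ?lt0r_neq0 ?mulr_gt0 //.
  rewrite ler_pM2l ?mulr_gt0 //; apply: le_trans (k1P l kl).
  rewrite /del ler_pdivrMr // exprVn -ler_pdivrMl ?exprn_gt0 ?invr_gt0 ?exprn_gt0 //.
  rewrite invrK; apply: (@le_trans _ _ (2 ^+ l)); last by rewrite lerXn2r ?nnegrE // ltW.
  by rewrite ler_piMr ?exprn_ge0.
(* The left side grows at most like th^l and the right side like Br^l, with th < Br: this is where
   tau < n enters. *)
have F3 l : good l -> (del l)^-1 `^ tau <= 16 * c * (M l)%:R.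
  move=> gl; have [_ kl _ _] := goodk l gl.
  have h1 : (del l)^-1 <= (bR `^ (1 + eps)) ^+ l * (e 0%N)^-1.
    rewrite /del invf_div; apply: (@le_trans _ _ ((bR / nu) ^+ l * (e 0%N)^-1)).
      rewrite expr_div_n -/(y l) -mulrA ler_pM2l // -invfM lef_pV2 ?posrE //.
        exact: ege.
      by rewrite mulr_gt0 ?exprn_gt0.
    rewrite ler_pM2r ?invr_gt0 //; apply: lerXn2r; rewrite ?nnegrE ?powR_ge0 //.
    by rewrite divr_ge0 // ltW.
  apply: (@le_trans _ _ (((bR `^ (1 + eps)) ^+ l * (e 0%N)^-1) `^ tau)).
    apply: (ge0_ler_powR (ltW tau0)); rewrite ?nnegrE ?invr_ge0 ?(ltW (del0 l)) //.
    by rewrite mulr_ge0 ?exprn_ge0 ?powR_ge0 // invr_ge0 ltW.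
  rewrite powRM ?exprn_ge0 ?powR_ge0 ?invr_ge0 ?(ltW (e0 0%N)) //.
  rewrite powR_exprn ?powR_ge0 // -powRrM -/th.
  have E0 : 0 < (e 0%N)^-1 `^ tau by rewrite powR_gt0 // invr_gt0.
  have := k2P l kl; rewrite expr_div_n ler_pdivrMr ?exprn_gt0 // -NR (NM l gl).
  set E := _ `^ tau in E0 *.
  have -> : 16 * c / (Br * E) * (Br * (M l)%:R) = 16 * c * (M l)%:R / E.
    by field; rewrite !lt0r_neq0.
  by rewrite ler_pdivlMr.
(* Here N del^d = b^l e_l^d, at least (b nu^d)^l e_0^d, and b nu^d >= 2^n / 2^d = 2. *)
have F4 l : good l -> 2 ^+ n <= (N l)%:R * del l ^+ d.
  move=> gl; have [_ _ kl _] := goodk l gl; rewrite Ndel.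
  apply: (@le_trans _ _ (y l * (nu ^+ l * e 0%N) ^+ d)); last first.
    rewrite ler_pM2l //; apply: lerXn2r; rewrite ?nnegrE ?(ltW (e0 l)) //.
      by rewrite mulr_ge0 ?exprn_ge0 // ltW.
    exact: ege.
  rewrite exprMn mulrA.
  have h : 2 ^+ l <= y l * (nu ^+ l) ^+ d.
    rewrite -exprM mulnC exprM -exprMn; apply: lerXn2r; rewrite ?nnegrE //.
      by rewrite mulr_ge0 ?exprn_ge0 // ltW.
    apply: (@le_trans _ _ (2 ^+ n * 2^-1 ^+ d)).
      by rewrite exprVn exprS mulfK // lt0r_neq0 ?exprn_gt0.
    apply: ler_pM; rewrite ?exprn_ge0 ?invr_ge0 //.
    by apply: lerXn2r; rewrite ?nnegrE ?invr_ge0 // ltW.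
  have := k3P l kl; rewrite ler_pdivlMr ?exprn_gt0 // exprVn mulrC ler_pdivrMr ?exprn_gt0 //.
  move=> /le_trans; apply; rewrite mulrC ler_pM2r ?exprn_gt0 //.
pose T l := 2 ^+ n / ((N l)%:R * del l ^+ d).
have T0 l : 0 < T l by rewrite divr_gt0 ?mulr_gt0 ?exprn_gt0.
have Acount l P : good l -> (0 < P)%N -> (M l <= P)%N ->
    (size [seq q <- iota 1 P | bohr alpha (del l) q])%:R <= C0 * (del l ^+ d * P%:R).
  move=> gl P0 MP; rewrite size_filter.
  apply: (@count_bohr_le R d alpha tau c) => //; first exact: F2.
  by apply: le_trans (F3 l gl) _; rewrite ler_pM2l ?mulr_gt0 // ler_nat.
have MN l : good l -> (M l <= N l)%N.
  by move=> gl; rewrite -(ler_nat R) (NM l gl) ler_peMl // (le_trans _ BrbR) // ltW.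
(* The proportion gained at a scale is, up to a constant, the term e_l^n of the divergent series. *)
have srE l : good l -> del l / (N l)%:R / (T l / (M l)%:R) = e l ^+ n / (2 ^+ n * Br).
  move=> gl; rewrite -Ndeln /T (NM l gl) [del l ^+ n]exprS.
  by field; rewrite !lt0r_neq0 ?exprn_gt0.
have x01 : 0 <= 2 ^+ d / (bR * Br) <= 2^-1.
  rewrite divr_ge0 ?exprn_ge0 ?mulr_ge0 ?(ltW bR0) ?(ltW Br0) //=.
  rewrite ler_pdivrMr ?mulr_gt0 //.
  have : 1 <= Br by apply: le_trans BrbR; exact: ltW.
  move: b2n; rewrite exprS => h1 h2.
  have : bR <= bR * Br by rewrite ler_peMr // ltW.
  by move=> h3; lra.
have XE l : X l = (bR * Br) ^+ l * e l ^+ d.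
  by rewrite /X expr2 -mulrA Ndel mulrA NR -exprMn [Br * bR]mulrC.
(* Since [l] is kept and nu >= 1/2, e_k <= 2^(l-k) e_l; thus the ball counts of earlier scales decay
   geometrically going back from [l]. *)
have Xratio k l : good l -> (k <= l)%N ->
    X k <= (2 ^+ d / (bR * Br)) ^+ (l - k) * X l.
  move=> gl kl; rewrite !XE -{2}(subnK kl) exprD expr_div_n.
  have -> : 2 ^+ d ^+ (l - k) / (bR * Br) ^+ (l - k) *
     ((bR * Br) ^+ (l - k) * (bR * Br) ^+ k * e l ^+ d) =
     (bR * Br) ^+ k * (2 ^+ (l - k) * e l) ^+ d.
    rewrite [(2 ^+ (l - k) * e l) ^+ d]exprMn -[2 ^+ d ^+ _]exprM mulnC exprM mulrA mulrA.
    by rewrite mulfVK ?lt0r_neq0 ?exprn_gt0 ?mulr_gt0 // [2 ^+ _ ^+ d * _ in LHS]mulrC -mulrA.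
  rewrite ler_pM2l ?exprn_gt0 ?mulr_gt0 //; apply: lerXn2r; rewrite ?nnegrE ?(ltW (e0 _)) //.
    by rewrite mulr_ge0 ?exprn_ge0 // ltW.
  rewrite -ler_pdivrMl ?exprn_gt0 //; apply: le_trans (Kdecay k l kl (goodK l gl)).
  rewrite ler_pM2r // -exprVn; apply: lerXn2r; rewrite ?nnegrE ?invr_ge0 //; exact: ltW.
have bound := @ubiquity_sum_bounded R a%:~R f W good
  (fun l => rationals_in a%:~R [seq q <- iota 1 (N l) | bohr alpha (del l) q && (M l < q)%N])
  (fun l => [seq (a%:~R + p%:R / q%:R, T l / q%:R) |
       q <- [seq q <- iota 1 (M l) | bohr alpha (del l) q], p <- iota 0 q.+1])
  (fun l => T l / (M l)%:R) (fun l => del l / (N l)%:R) (fun l => 2 * C0 * X l) f0 mW.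
have {}bound m : \sum_(l < m | good l) del l / (N l)%:R / (T l / (M l)%:R) <= 18 / f.
  apply: bound => [|l gl|l gl|l gl beta ab|l gl|l gl|l gl|l gl].
  - by rewrite fE.
  - split; last by rewrite ler_pdivrMr // mul1r (le_trans (del1 l)) // ler1n.
    rewrite divr_gt0 //=; suff : del l / (N l)%:R / (T l / (M l)%:R) <= 1.
      move=> h; rewrite -[leRHS]mul1r -ler_pdivrMr; [exact: h|exact: divr_gt0].
    rewrite (srE l gl) ler_pdivrMr ?mulr_gt0 ?exprn_gt0 // mul1r.
    apply: (@le_trans _ _ 1); first by rewrite exprn_ile1 // ltW.
    rewrite -[leLHS]mulr1; apply: ler_pM => //; first by rewrite exprn_ege1 // ler1n.
    by apply: le_trans BrbR; exact: ltW.
  - split.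
      by move=> _ /allpairsPdep[q [p [_ _ ->]]] /=; rewrite divr_ge0 // ltW.
    apply: le_trans (sum_low_radii _ (ltW (T0 l)) _) _.
      by move=> q; rewrite mem_filter mem_iota => /andP[_ /andP[]].
    apply: le_trans (ler_wpM2l _ (Acount l (M l) gl (M0 l) (leqnn _))) _.
      by rewrite mulr_ge0 // ltW.
    (* The dependence on [l] cancels, leaving a constant over b^n for the measure of the low
       balls. *)
    have -> : 4 * T l * (C0 * (del l ^+ d * (M l)%:R)) = 4 * 2 ^+ n * C0 / Br.
      rewrite /T (NM l gl); field; rewrite !lt0r_neq0 ?exprn_gt0 //.
    rewrite ler_pdivlMr //; apply: le_trans bC; rewrite p7 exprS.
    have -> : 4 * (2 * 2 ^+ d) * C0 / Br * 4 = 32 * 2 ^+ d * C0 * Br^-1 by ring.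
    apply: ler_pM; rewrite ?invr_ge0 ?mulr_ge0 ?exprn_ge0 ?(ltW C00) ?(ltW Br0) //.
      rewrite ler_pM2r // [leRHS]mulrC; apply: ler_pM; rewrite ?exprn_ge0 //.
        by rewrite ler_nat.
      by rewrite ler_peMr ?exprn_ge0 // exprn_ege1 // ler1n.
    by rewrite lef_pV2 ?posrE.
  - apply: (@scale_coverage R d alpha a%:~R (del l) (N l) (M l)) => //.
      by rewrite del0 del1.
    exact: F4.
  - by apply: balls_sub_approx_tail => //; rewrite ?QM // del0 delpsi.
  - apply: rationals_in_itv => q; rewrite mem_filter mem_iota => /andP[_ /andP[]] //.
  - apply: (@le_trans _ _ (2 * (N l)%:R * (size [seq q <- iota 1 (N l) | bohr alpha (del l) q])%:R)).
      rewrite -!natrM ler_nat; apply: leq_trans (size_rationals_in (N := N l) _ _) _.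
        move=> q; rewrite mem_filter mem_iota add1n ltnS => /andP[_] //.
      rewrite leq_mul2l; apply/orP; right; rewrite !size_filter.
      by apply: sub_count => q /andP[].
    apply: le_trans (ler_wpM2l _ (Acount l (N l) gl (N0 l) (MN l gl))) _.
      by rewrite mulr_ge0.
    by rewrite le_eqVlt; apply/orP; left; apply/eqP; rewrite /X; ring.
  rewrite /= -mulr_sumr mulrA.
  have Xs : \sum_(k < l | good k) X k <= 2 * (2 ^+ d / (bR * Br)) * X l.
    apply: (@le_trans _ _ (\sum_(k < l) X k)).
      by rewrite [leRHS](bigID (fun k : 'I_l => good k)) /= lerDl sumr_ge0 // => k _; exact: ltW.
    apply: (@le_trans _ _ (\sum_(k < l) (2 ^+ d / (bR * Br)) ^+ (l - k) * X l)).
      by apply: ler_sum => k _; apply: Xratio => //; rewrite ltnW.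
    rewrite -mulr_suml ler_wpM2r ?(ltW (X0 l)) //; exact: sum_geometric_tail_le.
  have c16 : 0 <= 16 * (T l / (M l)%:R) * (2 * C0).
    by apply: mulr_ge0; apply: mulr_ge0 => //; apply: ltW => //; exact: divr_gt0.
  apply: le_trans (ler_wpM2l c16 Xs) _.
  (* The product of radius and ball count is 2^n b^n times constants; the geometric ratio turns this
     into a constant over b. *)
  have -> : 16 * (T l / (M l)%:R) * (2 * C0) * (2 * (2 ^+ d / (bR * Br)) * X l)
     = 2 ^+ n * 2 ^+ d * 64 * C0 / bR.
    rewrite /T /X (NM l gl); field.
    by rewrite !lt0r_neq0 ?exprn_gt0.
  apply: le_trans bC; rewrite p7 exprS le_eqVlt; apply/orP; left; apply/eqP; ring.
(* The kept sum is chosen to exceed what the first [k0] scales, each contributing at most 1, and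
   [bound] together allow. *)
have [|m] := @kept_sums_diverge R psi n b nu (k0%:R + 18 / f * (2 ^+ n * Br)) psiA isT b2 _ psioo.
  by rewrite (ltW nu0) nu1.
rewrite ltNge => /negP; apply.
have u01 k : 0 <= e k ^+ n <= 1.
  by rewrite exprn_ge0 ?exprn_ile1 // ltW.
apply: le_trans (@sum_kept_le_tail R K (fun l => e l ^+ n) k0 m u01) _.
rewrite lerD2l -ler_pdivrMr ?mulr_gt0 ?exprn_gt0 // mulr_suml.
apply: le_trans (bound m); rewrite le_eqVlt; apply/orP; left; apply/eqP.
by apply: eq_bigr => l gl; rewrite srE.
Qed.

(** * Almost every point and conclusion *)

Lemma approx_tails_approximable (R : realType) (d : nat) (alpha : 'rV[R]_d.+1.-1)
    (psi : R -> R) (beta : R) : approximating_function psi ->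
  (forall Q, approx_tail alpha psi Q beta) ->
  approximable psi (@line_point R d.+1 alpha beta).
Proof.
move=> [psi0 _] tails; apply: unbounded_infinite_set => Q.
have [q [Qq q0 /asboolP qb] [z _ qz]] := tails Q.
have qR0 : 0 < q%:R :> R by rewrite ltr0n.
exists q => //; split=> //.
apply/dist_line_point_ltP; [by []|exact: psi0|split; first exact: qb].
exists z; move: qz; rewrite /ball /= ltr_pdivlMr // -[X in _ * X](gtr0_norm qR0) -normrM.
by rewrite mulrBl mulfVK ?lt0r_neq0 // distrC [beta * _]mulrC.
Qed.

Lemma dual_type_lt_khintchine_divergence (R : realType) (n : nat)
    (alpha : 'rV[R]_n.-1) : (2 <= n)%N ->
  (dual_type alpha < n%:R%:E)%E -> @khintchine_divergence_line R n alpha.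
Proof.
(* With n = d + 1, the hypothesis [2 <= d.+1] is convertible to [0 < d], so [d0] serves in both
   forms. *)
case: n alpha => // d alpha d0 typen psi psiA psioo.
have [tau [c [tau1 taun c0 sep]]] := dual_type_lt_separation d0 typen.
have tau0 : 0 < tau by apply: lt_le_trans tau1.
have null a Q : lebesgue_measure.-negligible
    (`[a%:~R, (a%:~R + 1)%R[ `\` approx_tail alpha psi Q : set R).
  apply/negligibleP; last exact: (approx_tail_full a Q d0 tau0 taun c0 sep psiA psioo).
  by apply: measurableD => //; exact: measurable_approx_tail.
(* The unit intervals are indexed by the integers, enumerated as [Posz j] and [Negz j]; with [Q]
   this makes a countable union of null sets. *)
have := negligible_bigcup (fun Q => negligible_bigcup (fun j =>
  negligibleU (null (Posz j) Q) (null (Negz j) Q))).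
apply: negligibleS => beta /= nbeta.
have [Q nQ] : exists Q, ~ approx_tail alpha psi Q beta.
  by apply/existsNP => tails; apply: nbeta; exact: approx_tails_approximable.
have bI : beta \in `[(Num.floor beta)%:~R, (Num.floor beta)%:~R + 1[.
  by rewrite in_itv /= floor_le /=; have := floorD1_gt beta; rewrite intrD.
exists Q => //; case: (Num.floor beta) bI => j bI; exists j => //; [left|right]; by split.
Qed.

Theorem theorem3p3 (R : realType) (n : nat) (hn : (2 <= n)%N)
    (alpha : 'rV[R]_n.-1) :
  ((n%:R%:E < dual_type alpha)%E ->
     @coord_line R n alpha `<=` @VWA R n) /\
  ((dual_type alpha < n%:R%:E)%E -> @khintchine_divergence_line R n alpha).
Proof.
by split; [exact: coord_line_subset_VWA|exact: dual_type_lt_khintchine_divergence].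
Qed.
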